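(* Let $Q$ be a cyclic hyperbolic quadrilateral with side lengths $a,b,c,d$. Then the area $S=S(Q)$ is given by the formula $$\cos\frac{S}{2}=\frac{\cosh a+\cosh b+\cosh c+\cosh d-4\sinh\frac{a}{2}\sinh\frac{b}{2}\sinh\frac{c}{2}\sinh\frac{d}{2}}{4\cosh\frac{a}{2}\cosh\frac{b}{2}\cosh\frac{c}{2}\cosh\frac{d}{2}}.$$
   Context: The hyperbolic plane carries the Riemannian metric of constant curvature $-1$. A cyclic polygon in the hyperbolic plane is a convex polygon inscribed in a circle, a horocycle, or one branch of an equidistant curve. *)

(* Defs.v *)
From mathcomp Require Import all_boot all_order all_algebra.
From mathcomp Require Import all_classical all_reals all_analysis.
Set Implicit Arguments.
Unset Strict Implicit.
Unset Printing Implicit Defensive.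
Import Order.TTheory GRing.Theory Num.Theory.
Import numFieldNormedType.Exports.
Local Open Scope classical_set_scope.
Local Open Scope ring_scope.

(* The hyperbolic plane is the Poincare upper half-plane {(x, y) | y > 0} with *)
(* the metric (dx^2 + dy^2) / y^2, which has constant curvature -1.            *)

Definition cosh {R : realType} (x : R) : R := (expR x + expR (- x)) / 2.
Definition sinh {R : realType} (x : R) : R := (expR x - expR (- x)) / 2.
Definition arcosh {R : realType} (x : R) : R := ln (x + Num.sqrt (x ^+ 2 - 1)).

Definition hplane {R : realType} : set (R * R) := [set z | 0 < z.2].

(* cosh d(z, w) = 1 + |z - w|^2 / (2 Im z Im w); meaningful on hplane only. *)
Definition hdist {R : realType} (z w : R * R) : R :=
  arcosh (1 + ((z.1 - w.1) ^+ 2 + (z.2 - w.2) ^+ 2) / (2 * z.2 * w.2)).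

(* Riemannian area: the area form of (dx^2 + dy^2) / y^2 is dx dy / y^2. *)
Definition harea {R : realType} (Q : set (R * R)) : R :=
  \int[(@lebesgue_measure R \x @lebesgue_measure R)%E]_(z in Q) (z.2 ^- 2).

Definition hsegment {R : realType} (z w : R * R) : set (R * R) :=
  [set p | hplane p /\ hdist z p + hdist p w = hdist z w].

Definition hconvex {R : realType} (K : set (R * R)) : Prop :=
  K `<=` hplane /\ forall z w, K z -> K w -> hsegment z w `<=` K.

Definition hhull {R : realType} (X : set (R * R)) : set (R * R) :=
  [set p | forall K, hconvex K -> X `<=` K -> K p].

(* Geodesic lines of the half-plane are the loci                             *)
(*   al (x^2 + y^2) + be x + ga = 0  with  be^2 - 4 al ga > 0 :              *)
(* for al = 0 the vertical half-lines, for al != 0 the half-circles centred  *)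
(* on the real axis.  The sign of the left-hand side tells apart the two     *)
(* sides of the line; (- al, - be, - ga) is the same line, sides exchanged.  *)
Record oline (R : realType) := Oline {
  al : R; be : R; ga : R;
  oline_disc : 0 < be ^+ 2 - 4 * al * ga }.

Definition oside {R : realType} (l : oline R) (z : R * R) : R :=
  al l * (z.1 ^+ 2 + z.2 ^+ 2) + be l * z.1 + ga l.

Definition line_pts {R : realType} (l : oline R) : set (R * R) :=
  [set z | hplane z /\ oside l z = 0].

Definition hdist_line {R : realType} (z : R * R) (l : oline R) : R :=
  inf [set hdist z w | w in line_pts l].

Definition is_hcircle {R : realType} (K : set (R * R)) : Prop :=
  exists (c : R * R) (r : R), [/\ hplane c, 0 < r &
    K = [set z | hplane z /\ hdist c z = r]].

(* Horizontal lines (horocycles centred at infinity), or Euclidean circles   *)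
(* tangent to the real axis at xi, with the point of tangency removed.       *)
Definition is_horocycle {R : realType} (K : set (R * R)) : Prop :=
  (exists h : R, 0 < h /\ K = [set z | z.2 = h]) \/
  (exists xi r : R, 0 < r /\
    K = [set z | hplane z /\ (z.1 - xi) ^+ 2 + (z.2 - r) ^+ 2 = r ^+ 2]).

(* One branch: the points at distance delta from l on its positive side. *)
Definition is_equidistant_branch {R : realType} (K : set (R * R)) : Prop :=
  exists (l : oline R) (delta : R), 0 < delta /\
    K = [set z | [/\ hplane z, 0 < oside l z & hdist_line z l = delta]].

(* The line through z and w has p and q strictly on the same side. *)
Definition supporting_side {R : realType} (z w p q : R * R) : Prop :=
  exists l : oline R, [/\ oside l z = 0, oside l w = 0,
    0 < oside l p & 0 < oside l q].

(* A, B, C, D are the successive vertices of a convex quadrilateral; the     *)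
(* conditions force them to be distinct, with no three on a geodesic.        *)
Definition convex_quadrilateral {R : realType} (A B C D : R * R) : Prop :=
  [/\ hplane A, hplane B, hplane C & hplane D] /\
  [/\ supporting_side A B C D, supporting_side B C D A,
      supporting_side C D A B & supporting_side D A B C].

Definition cyclic_quadrilateral {R : realType} (A B C D : R * R) : Prop :=
  convex_quadrilateral A B C D /\
  exists K : set (R * R),
    [\/ is_hcircle K, is_horocycle K | is_equidistant_branch K] /\
    [/\ K A, K B, K C & K D].

Definition quadrilateral {R : realType} (A B C D : R * R) : set (R * R) :=
  hhull [set A; B; C; D].

(* Main.v *)
Require Import Defs.
From mathcomp Require Import all_boot all_order all_algebra.
From mathcomp Require Import all_classical all_reals all_analysis.
From mathcomp Require Import measurable_realfun zify ring lra.
Import Order.TTheory GRing.Theory Num.Theory.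
Import numFieldNormedType.Exports.
Local Open Scope classical_set_scope.
Local Open Scope ring_scope.

(** Write z = x + iy.  In the coordinates (x, |z|^2) the half-plane becomes the
    region above a parabola and geodesics become straight lines, so convexity
    and orientation are those of the affine plane: [hsegmentP] and
    [klein_comb_hsegment] identify the metric segments with the affine ones,
    and [quadrilateral_region] identifies the convex hull of the vertices with
    the intersection of the four half-planes bounded by the sides.

    The area comes from Green's theorem: dx dy / y^2 is the differential of
    dx / y, and on a geodesic arc from P to Q the integral of dx / y is the
    angle 2 atan ((x_Q - x_P) / (y_P + y_Q)).  In measure-theoretic terms this
    angle is the area of the region lying above the arc ([integral_upper], by
    Fubini and two antiderivatives).  A point off finitely many lines lies in
    a positively oriented polygon exactly when the edges below it, counted with
    the sign of x_Q - x_P, sum to one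
    ([triangle_crossing], [quad_crossing]), so the area of the quadrilateral is
    the signed sum of the four angles ([harea_quad_region]).  Hence S / 2 is an
    argument of the product of the four numbers (y_P + y_Q) + i (x_Q - x_P).
    The modulus of such a factor is 2 cosh (PQ / 2) sqrt (y_P y_Q)
    ([cos_edge], [sin_edge]), which produces the denominator of the formula.

    The real part of the product is the numerator.  Expanding it gives, for any
    four points, the four terms in cosh and the real part of
      G = (B - A) (D - C) conj ((C - B) (A - D))
    ([product_identity]).  Circles, horocycles and equidistant curves are the
    loci on which y is an affine function of x and |z|^2
    ([cycle_klein_affine]), that is, Euclidean circles and lines; so for a
    cyclic quadrilateral the cross-ratio behind G is real, and it is negative
    because A, B, C, D is the order on the cycle ([ccw_concyclic_edges]).
    Thus G = - |G|, and |PQ| = 2 sinh (PQ / 2) sqrt (y_P y_Q) turns |G| into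
    the product of the four sinh ([prod_sinh_half]). *)

(** * Hyperbolic functions *)

Section Cosh.
Context {R : realType}.
Implicit Types x y : R.

Lemma cosh_sinh_sqr x : cosh x ^+ 2 - sinh x ^+ 2 = 1.
Proof.
rewrite /cosh /sinh -[RHS](expRxMexpNx_1 x).
by field.
Qed.

Lemma sqr_sinh x : sinh x ^+ 2 = cosh x ^+ 2 - 1.
Proof. by rewrite -(cosh_sinh_sqr x) subKr. Qed.

Lemma coshD x y : cosh (x + y) = cosh x * cosh y + sinh x * sinh y.
Proof. by rewrite /cosh /sinh opprD !expRD; field. Qed.

Lemma sinh_ge0 x : 0 <= x -> 0 <= sinh x.
Proof.
move=> x0; rewrite /sinh divr_ge0 // subr_ge0 ler_expR; lra.
Qed.

Lemma cosh_ge1 x : 1 <= cosh x.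
Proof.
have := sqr_ge0 (sinh x); have := cosh_sinh_sqr x.
have : 0 < cosh x by rewrite /cosh divr_gt0 // addr_gt0 // expR_gt0.
nra.
Qed.

Lemma cosh_gt0 x : 0 < cosh x.
Proof. exact: lt_le_trans ltr01 (cosh_ge1 x). Qed.

Lemma sqr_cosh_half x : cosh (x / 2) ^+ 2 = (cosh x + 1) / 2.
Proof.
have -> : cosh x = cosh (x / 2 + x / 2) by congr cosh; field.
rewrite coshD; have := cosh_sinh_sqr (x / 2); lra.
Qed.

Lemma sqr_sinh_half x : sinh (x / 2) ^+ 2 = (cosh x - 1) / 2.
Proof.
have := sqr_cosh_half x; have := cosh_sinh_sqr (x / 2); lra.
Qed.

Lemma cosh_inj x y : 0 <= x -> 0 <= y -> cosh x = cosh y -> x = y.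
Proof.
move=> x0 y0 xy.
have sxy : sinh x = sinh y.
  apply/eqP; rewrite -(@eqrXn2 _ 2) ?sinh_ge0 //.
  apply/eqP; have := cosh_sinh_sqr x; have := cosh_sinh_sqr y; rewrite xy; lra.
apply: expR_inj; move: xy sxy; rewrite /cosh /sinh; lra.
Qed.

Lemma ler_cosh x y : 0 <= x -> 0 <= y -> cosh x <= cosh y -> x <= y.
Proof.
move=> x0 y0 xy; rewrite leNgt; apply/negP => yx.
have h0 : 0 <= x - y by rewrite subr_ge0 ltW.
suff e : x = y by rewrite e ltxx in yx.
apply: cosh_inj => //; apply/eqP; rewrite eq_le xy /=.
rewrite -[x](subrK y) coshD addrC.
have s0 : 0 <= sinh (x - y) * sinh y by rewrite mulr_ge0 ?sinh_ge0.
have c0 : 0 <= cosh y by rewrite (le_trans ler01) ?cosh_ge1.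
apply: (le_trans _ (_ : cosh (x - y) * cosh y <= _)); last by rewrite lerDr.
by rewrite ler_peMl ?cosh_ge1.
Qed.

Lemma arcosh_ge0 x : 1 <= x -> 0 <= arcosh x.
Proof.
move=> x1; rewrite /arcosh ln_ge0 //.
by rewrite (le_trans x1) // lerDl sqrtr_ge0.
Qed.

Lemma arcoshK x : 1 <= x -> cosh (arcosh x) = x.
Proof.
move=> x1; rewrite /cosh /arcosh.
set s := Num.sqrt _.
have s0 : 0 <= s by rewrite sqrtr_ge0.
have s2 : s ^+ 2 = x ^+ 2 - 1 by rewrite sqr_sqrtr //; nra.
have xs : 0 < x + s by lra.
rewrite expRN lnK ?posrE //.
have -> : (x + s)^-1 = x - s.
  by apply: (mulfI (lt0r_neq0 xs)); rewrite divff ?lt0r_neq0 //; lra.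
by field.
Qed.

End Cosh.

(** * Distances and segments in the projective model *)
Section Dist.
Context {R : realType}.
Implicit Types z w p : R * R.

(** Paired with the abscissa, this gives the affine coordinates of a projective
    model: [(z.1, sqnorm z)] ranges over the region above the parabola t = x^2,
    and geodesics are straight lines. *)
Definition sqnorm z : R := z.1 ^+ 2 + z.2 ^+ 2.

(** The Minkowski form on the vectors (sqnorm z, z.1, 1), normalised so that
    its value at (z, z) is [z.2 ^+ 2]; dividing by [z.2] and [w.2] therefore
    places the two vectors on the hyperboloid, where the form is cosh of the
    distance. *)
Definition hform z w : R := (sqnorm z + sqnorm w) / 2 - z.1 * w.1.

Lemma hdist_arg_ge1 z w : hplane z -> hplane w ->
  1 <= 1 + ((z.1 - w.1) ^+ 2 + (z.2 - w.2) ^+ 2) / (2 * z.2 * w.2).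
Proof.
rewrite /hplane /= => z0 w0; rewrite lerDl divr_ge0 ?addr_ge0 ?sqr_ge0 //.
by rewrite !mulr_ge0 // ltW.
Qed.

Lemma cosh_hdist z w : hplane z -> hplane w ->
  cosh (hdist z w) = hform z w / (z.2 * w.2).
Proof.
move=> z0 w0; rewrite arcoshK ?hdist_arg_ge1 //.
rewrite /hplane /= in z0 w0; rewrite /hform /sqnorm.
by field; rewrite !lt0r_neq0.
Qed.

Lemma hdist_ge0 z w : hplane z -> hplane w -> 0 <= hdist z w.
Proof. by move=> z0 w0; rewrite arcosh_ge0 ?hdist_arg_ge1. Qed.

Lemma hdistC z w : hdist z w = hdist w z.
Proof.
by rewrite /hdist; congr (arcosh (1 + _ / _)); ring.
Qed.

(** The orientation determinant of three points in the coordinates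
    [(z.1, sqnorm z)]; it vanishes exactly on geodesic triples. *)
Definition orient (A B C : R * R) : R :=
  (B.1 - A.1) * (sqnorm C - sqnorm A) - (sqnorm B - sqnorm A) * (C.1 - A.1).

(** The left-hand side is the Gram determinant 1 + 2XYZ - X^2 - Y^2 - Z^2 of
    three points of the hyperboloid, hence the square of a determinant.  The
    triangle inequality is an equality only when it vanishes. *)
Lemma gram_points z p w : hplane z -> hplane p -> hplane w ->
  let X := cosh (hdist z p) in let Y := cosh (hdist p w) in
  let Z := cosh (hdist z w) in
  (X ^+ 2 - 1) * (Y ^+ 2 - 1) - (Z - X * Y) ^+ 2 =
  orient z p w ^+ 2 / (2 * z.2 * p.2 * w.2) ^+ 2.
Proof.
move=> z0 p0 w0 X Y Z; rewrite /X /Y /Z !cosh_hdist //.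
rewrite /hplane /= in z0 p0 w0; rewrite /hform /orient /sqnorm.
by field; rewrite !lt0r_neq0.
Qed.

(** Affine combination in the projective model; [s] is not the hyperbolic
    arc length parameter. *)
Definition klein_comb s z w p :=
  p.1 = (1 - s) * z.1 + s * w.1 /\ sqnorm p = (1 - s) * sqnorm z + s * sqnorm w.

(** For a point aligned with z and w, being between them is the sign of
    s (1 - s); this identity reads that sign off from the three distances. *)
Lemma klein_comb_between s z w p : hplane z -> hplane p -> hplane w ->
  klein_comb s z w p ->
  cosh (hdist z w) - cosh (hdist z p) * cosh (hdist p w) =
  s * (1 - s) * z.2 * w.2 / p.2 ^+ 2 * (cosh (hdist z w) ^+ 2 - 1).
Proof.
move=> z0 p0 w0 [p1 pt]; rewrite !cosh_hdist // /hform.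
rewrite /hplane /= in z0 p0 w0.
have p22 : p.2 ^+ 2 = (1 - s) ^+ 2 * z.2 ^+ 2 + 2 * s * (1 - s) * hform z w
    + s ^+ 2 * w.2 ^+ 2.
  have -> : p.2 ^+ 2 = sqnorm p - p.1 ^+ 2 by rewrite /sqnorm; ring.
  by rewrite pt p1 /hform /sqnorm; field.
have zp : hform z p = (1 - s) * z.2 ^+ 2 + s * hform z w.
  by rewrite /hform pt p1 /sqnorm; field.
have pw : hform p w = (1 - s) * hform z w + s * w.2 ^+ 2.
  by rewrite /hform pt p1 /sqnorm; field.
have -> : hform z w / (z.2 * w.2) - hform z p / (z.2 * p.2) * (hform p w / (p.2 * w.2))
  = (hform z w * p.2 ^+ 2 - hform z p * hform p w) / (z.2 * w.2 * p.2 ^+ 2).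
  by field; rewrite !lt0r_neq0.
have -> : s * (1 - s) * z.2 * w.2 / p.2 ^+ 2 * ((hform z w / (z.2 * w.2)) ^+ 2 - 1)
  = s * (1 - s) * (hform z w ^+ 2 - z.2 ^+ 2 * w.2 ^+ 2) / (z.2 * w.2 * p.2 ^+ 2).
  by field; rewrite !lt0r_neq0.
by congr (_ / _); rewrite p22 zp pw; ring.
Qed.

Lemma orient_klein_comb s z w p : klein_comb s z w p -> orient z p w = 0.
Proof. by case=> p1 pt; rewrite /orient pt p1; ring. Qed.

(** Since p is aligned with z and w, Z - XY and sinh a sinh b have the same
    square; being between makes both nonnegative, so cosh (a + b) = Z. *)
Lemma klein_comb_hsegment s z w p : hplane z -> hplane w -> hplane p ->
  0 <= s -> s <= 1 -> klein_comb s z w p -> hsegment z w p.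
Proof.
move=> z0 w0 p0 s0 s1 zwp; split => //.
have := klein_comb_between s z w p z0 p0 w0 zwp.
have := gram_points z p w z0 p0 w0; rewrite /= (orient_klein_comb s) // expr0n /= mul0r.
have := cosh_ge1 (hdist z w).
set Z := cosh (hdist z w); set X := cosh _; set Y := cosh _ => Z1 G B.
have ZXY : 0 <= Z - X * Y.
  rewrite B mulr_ge0 //; last by nra.
  rewrite /hplane /= in z0 w0 p0.
  rewrite divr_ge0 ?sqr_ge0 // mulr_ge0 ?(ltW w0) // mulr_ge0 ?(ltW z0) //.
  by rewrite mulr_ge0 // subr_ge0.
apply: cosh_inj; rewrite ?addr_ge0 ?hdist_ge0 // coshD -/X -/Y -/Z.
(* cosh (a + b) = XY + sinh a sinh b *)
suff -> : sinh (hdist z p) * sinh (hdist p w) = Z - X * Y by rewrite addrC subrK.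
apply/eqP; rewrite -(@eqrXn2 _ 2) //; last first.
  by rewrite mulr_ge0 // sinh_ge0 // hdist_ge0.
apply/eqP; rewrite exprMn !sqr_sinh -/X -/Y.
by apply/eqP; rewrite -subr_eq0 G.
Qed.

Lemma hdist_eq0 z w : hplane z -> hplane w -> cosh (hdist z w) = 1 -> z = w.
Proof.
move=> z0 w0; rewrite arcoshK ?hdist_arg_ge1 // -[RHS]addr0 => /addrI /eqP.
rewrite mulf_eq0 invr_eq0 => /orP[|]; last first.
  by rewrite /hplane /= in z0 w0; rewrite !mulf_eq0 !gt_eqF.
rewrite paddr_eq0 ?sqr_ge0 // !sqrf_eq0 !subr_eq0 => /andP[/eqP z1 /eqP z2].
by rewrite (surjective_pairing z) z1 z2 -surjective_pairing.
Qed.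

Lemma orient0_klein_comb z w p : z.1 != w.1 \/ sqnorm z != sqnorm w ->
  orient z p w = 0 -> exists s, klein_comb s z w p.
Proof.
move=> neq; rewrite /orient => ori.
(* the parameter of the orthogonal projection of p on the line z w, for the
   Euclidean structure of the coordinates (x, sqnorm) *)
exists (((p.1 - z.1) * (w.1 - z.1) + (sqnorm p - sqnorm z) * (sqnorm w - sqnorm z)) /
  ((w.1 - z.1) ^+ 2 + (sqnorm w - sqnorm z) ^+ 2)).
have N0 : (w.1 - z.1) ^+ 2 + (sqnorm w - sqnorm z) ^+ 2 != 0.
  rewrite paddr_eq0 ?sqr_ge0 // !sqrf_eq0 !subr_eq0 negb_and.
  by apply/orP; case: neq => h; [left|right]; rewrite eq_sym.
rewrite /klein_comb; set s := _ / _.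
have sN : s * ((w.1 - z.1) ^+ 2 + (sqnorm w - sqnorm z) ^+ 2) =
    (p.1 - z.1) * (w.1 - z.1) + (sqnorm p - sqnorm z) * (sqnorm w - sqnorm z).
  by rewrite /s divfK.
move: sN N0; move: (s) (sqnorm p) (sqnorm z) (sqnorm w) ori => r t u v ori sN N0.
have bE : p.1 * (v - u) = z.1 * (v - u) + (t - u) * (w.1 - z.1).
  by apply/eqP; rewrite -subr_eq0 -ori; apply/eqP; ring.
split; apply: (mulIf N0).
  have -> : ((1 - r) * z.1 + r * w.1) * ((w.1 - z.1) ^+ 2 + (v - u) ^+ 2) =
     z.1 * ((w.1 - z.1) ^+ 2 + (v - u) ^+ 2) +
     (r * ((w.1 - z.1) ^+ 2 + (v - u) ^+ 2)) * (w.1 - z.1) by ring.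
  rewrite sN.
  have -> : p.1 * ((w.1 - z.1) ^+ 2 + (v - u) ^+ 2) =
    p.1 * (w.1 - z.1) ^+ 2 + p.1 * (v - u) * (v - u) by ring.
  by rewrite bE; ring.
have -> : ((1 - r) * u + r * v) * ((w.1 - z.1) ^+ 2 + (v - u) ^+ 2) =
   u * ((w.1 - z.1) ^+ 2 + (v - u) ^+ 2) +
   (r * ((w.1 - z.1) ^+ 2 + (v - u) ^+ 2)) * (v - u) by ring.
rewrite sN mulrDl [_ * _ * (v - u)]mulrAC mulrBl bE; ring.
Qed.

Lemma sqnorm_inj z w : hplane z -> hplane w ->
  z.1 = w.1 -> sqnorm z = sqnorm w -> z = w.
Proof.
rewrite /hplane /sqnorm /= => z0 w0 e1; rewrite e1 => /addrI /eqP.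
rewrite eqrXn2 ?(ltW z0) ?(ltW w0) // => /eqP e2.
by rewrite (surjective_pairing z) e1 e2 -surjective_pairing.
Qed.

Lemma mulr_onem_ge0 (s : R) : 0 <= s * (1 - s) -> 0 <= s /\ s <= 1.
Proof. by move=> ss; split; nra. Qed.

(** Additivity of the distances makes Z - XY equal to sinh a sinh b, so the
    Gram determinant vanishes (p is aligned with z and w), and the sign of
    Z - XY puts p between them. *)
Lemma hsegmentP z w p : hplane z -> hplane w -> hsegment z w p ->
  exists s, [/\ 0 <= s, s <= 1 & klein_comb s z w p].
Proof.
move=> z0 w0 [p0 dd].
have C : cosh (hdist z w) - cosh (hdist z p) * cosh (hdist p w) =
     sinh (hdist z p) * sinh (hdist p w) by rewrite -dd coshD addrAC subrr add0r.
have := cosh_ge1 (hdist z w); rewrite le_eqVlt => /orP[/eqP Z1|Z1].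
  have zw : z = w by apply: hdist_eq0.
  have d0 : hdist z w = 0.
    apply: cosh_inj => //; first exact: hdist_ge0.
    by rewrite -Z1 /cosh oppr0 expR0; field.
  have := hdist_ge0 z p z0 p0; have := hdist_ge0 p w p0 w0 => h1 h2.
  have zp : z = p.
    apply: hdist_eq0 => //; have -> : hdist z p = 0.
      apply/eqP; rewrite eq_le h2 andbT.
      by rewrite -[X in _ <= X]d0 -dd lerDl.
    by rewrite -d0.
  by exists 0; split; rewrite ?ler01 // -zp /klein_comb; split; ring.
have G := gram_points z p w z0 p0 w0; move: G; rewrite /= C.
rewrite (exprMn _ (sinh (hdist z p))) !sqr_sinh subrr.
move/esym/eqP.
rewrite /hplane /= in z0 w0 p0.
have /negPf nz : (2 * z.2 * p.2 * w.2) ^+ 2 != 0.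
  by rewrite lt0r_neq0 // exprn_gt0 // !mulr_gt0.
rewrite mulf_eq0 invr_eq0 nz orbF sqrf_eq0 => /eqP ori.
have [|s zwp] := orient0_klein_comb z w p _ ori.
  have [e1'|] := eqVneq z.1 w.1; last by left.
  have [e2'|] := eqVneq (sqnorm z) (sqnorm w); last by right.
  move: Z1; rewrite (sqnorm_inj z w) // arcoshK; last exact: hdist_arg_ge1.
  by rewrite !subrr !expr0n /= addr0 mul0r addr0 ltxx.
exists s.
have := klein_comb_between s z w p z0 p0 w0 zwp.
rewrite C => B.
have : 0 <= s * (1 - s) * (z.2 * w.2 / p.2 ^+ 2 * (cosh (hdist z w) ^+ 2 - 1)).
  rewrite !mulrA -B; apply: mulr_ge0; apply: sinh_ge0; exact: hdist_ge0.
rewrite pmulr_lge0; first by move/mulr_onem_ge0 => [s0 s1]; split.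
rewrite mulr_gt0 ?divr_gt0 ?exprn_gt0 ?mulr_gt0 //.
by rewrite subr_gt0 exprn_egt1.
Qed.
End Dist.

(** * The convex hull of four vertices *)

Section Hull.
Context {R : realType}.
Implicit Types z w p A B C D : R * R.

(** Strict convexity of the polygon, in the positive orientation. *)
Definition ccw_quad A B C D : Prop :=
  [/\ 0 < orient A B C, 0 < orient B C D, 0 < orient C D A & 0 < orient D A B].

Definition quad_region A B C D : set (R * R) :=
  [set z | hplane z /\ [/\ 0 <= orient A B z, 0 <= orient B C z,
                           0 <= orient C D z & 0 <= orient D A z]].

Lemma orient_affine A B s z w p : klein_comb s z w p ->
  orient A B p = (1 - s) * orient A B z + s * orient A B w.
Proof. by case=> p1 pt; rewrite /orient pt p1; ring. Qed.

Lemma orient_cycle A B C : orient B C A = orient A B C.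
Proof. by rewrite /orient; ring. Qed.

Lemma orient_swap A B C : orient B A C = - orient A B C.
Proof. by rewrite /orient; ring. Qed.

Lemma orient_eq0l A B : orient A B A = 0.
Proof. by rewrite /orient; ring. Qed.

Lemma orient_eq0r A B : orient A B B = 0.
Proof. by rewrite /orient; ring. Qed.

Lemma hconvex_quad_region A B C D : hconvex (quad_region A B C D).
Proof.
split => [z []//|z w [z0 [z1 z2 z3 z4]] [w0 [w1 w2 w3 w4]] p zwp].
have [s [s0 s1 kc]] := hsegmentP z w p z0 w0 zwp.
have s1' : 0 <= 1 - s by lra.
split; first by case: zwp.
by split; rewrite (orient_affine _ _ _ _ _ _ kc) addr_ge0 // mulr_ge0.
Qed.

(** The region above the parabola is convex: every affine combination of two
    points of the half-plane lifts back to the half-plane. *)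
Lemma klein_comb_lift s z w : hplane z -> hplane w -> 0 <= s -> s <= 1 ->
  exists2 p, hplane p & klein_comb s z w p.
Proof.
rewrite /hplane /= => z0 w0 s0 s1.
pose x := (1 - s) * z.1 + s * w.1.
pose t := (1 - s) * sqnorm z + s * sqnorm w.
have tx : 0 < t - x ^+ 2.
  have -> : t - x ^+ 2 =
      (1 - s) * z.2 ^+ 2 + s * w.2 ^+ 2 + s * (1 - s) * (z.1 - w.1) ^+ 2.
    by rewrite /t /x /sqnorm; ring.
  have z2 : 0 < z.2 ^+ 2 by rewrite exprn_gt0.
  have w2 : 0 < w.2 ^+ 2 by rewrite exprn_gt0.
  apply: ltr_wpDr; first by rewrite mulr_ge0 ?sqr_ge0 // mulr_ge0 // subr_ge0.
  have [->|sn0] := eqVneq s 0; first by rewrite subr0 mul1r mul0r addr0.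
  apply: ltr_wpDl; first by rewrite mulr_ge0 ?(ltW z2) ?subr_ge0.
  by rewrite mulr_gt0 // lt0r sn0.
exists (x, Num.sqrt (t - x ^+ 2)); first by rewrite /= sqrtr_gt0.
by split; rewrite // {1}/sqnorm /= sqr_sqrtr ?(ltW tx) // addrC subrK.
Qed.

(** The three orientations are barycentric coordinates of p.  Two segments
    reach it: one from B to C ending at q, one from A to q. *)
Lemma triangle_sub_hconvex A B C (K : set (R * R)) p :
  hplane A -> hplane B -> hplane C -> hconvex K -> K A -> K B -> K C ->
  0 < orient A B C -> hplane p ->
  0 <= orient A B p -> 0 <= orient B C p -> 0 <= orient C A p -> K p.
Proof.
move=> A0 B0 C0 [_ Kc] KA KB KC.
set d := orient A B C => d0 p0.
have : orient A B p + orient B C p + orient C A p = d.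
  by rewrite /d /orient; ring.
have : p.1 * d = orient B C p * A.1 + orient C A p * B.1 + orient A B p * C.1.
  by rewrite /d /orient; ring.
have : sqnorm p * d =
    orient B C p * sqnorm A + orient C A p * sqnorm B + orient A B p * sqnorm C.
  by rewrite /d /orient; ring.
move: (orient A B p) (orient B C p) (orient C A p) => c a b ep e1 es c0 a0 b0.
(* when b + c = 0 the point q is undefined, but then p = A *)
have [bc0|bc] := eqVneq (b + c) 0.
  have [b00 c00] : b = 0 /\ c = 0 by split; lra.
  have ad : a = d by lra.
  suff -> : p = A by [].
  apply: sqnorm_inj => //; apply: (mulIf (lt0r_neq0 d0)).
    by rewrite e1 ad b00 c00; ring.
  by rewrite ep ad b00 c00; ring.
have bcp : 0 < b + c by rewrite lt0r bc addr_ge0.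
have [||q q0 qBC] := klein_comb_lift (c / (b + c)) B C B0 C0.
- by rewrite divr_ge0 // ltW.
- by rewrite ler_pdivrMr // mul1r lerDr.
have Kq : K q.
  apply: (Kc B C KB KC); apply: (klein_comb_hsegment _ _ _ _ B0 C0 q0 _ _ qBC).
  - by rewrite divr_ge0 // ltW.
  - by rewrite ler_pdivrMr // mul1r lerDr.
apply: (Kc A q KA Kq).
apply: (klein_comb_hsegment ((b + c) / d)) => //.
- by rewrite divr_ge0 // ltW.
- by rewrite ler_pdivrMr // mul1r; lra.
have dn := lt0r_neq0 d0.
have ae : a = d - b - c by lra.
case: qBC => q1 qt; split; apply: (mulIf dn); rewrite ?e1 ?ep ?q1 ?qt ae.
  by field; rewrite dn bc.
by field; rewrite dn bc.
Qed.

(** The diagonal AC cuts the region into two triangles, each of which lies in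
    every convex set containing its vertices; conversely the region is
    convex. *)
Lemma quadrilateral_region A B C D :
  hplane A -> hplane B -> hplane C -> hplane D ->
  ccw_quad A B C D -> quadrilateral A B C D = quad_region A B C D.
Proof.
move=> A0 B0 C0 D0 [ABC BCD CDA DAB]; apply/seteqP; split => p.
  apply; first exact: hconvex_quad_region.
  by move=> z /= [[[->|->]|->]|->]; split => //; split;
    rewrite ?orient_eq0l ?orient_eq0r // ltW // orient_cycle.
case=> p0 [p1 p2 p3 p4] K Kc sub.
have KA : K A by apply: sub; rewrite /=; tauto.
have KB : K B by apply: sub; rewrite /=; tauto.
have KC : K C by apply: sub; rewrite /=; tauto.
have KD : K D by apply: sub; rewrite /=; tauto.
have [CA|/ltW CA] := leP 0 (orient C A p).
  exact: (triangle_sub_hconvex A B C).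
apply: (triangle_sub_hconvex C D A) => //.
by rewrite orient_swap oppr_ge0.
Qed.

End Hull.

(** * Two integrals computed by antiderivatives *)

Section Calculus.
Context {R : realType}.
Notation mu := (@lebesgue_measure R).

Lemma integral_itvoo_FTC (f F : R -> R) (a b : R) : a < b ->
  {in `[a, b], forall x : R, is_derive x (1 : R) F (f x)} ->
  {in `[a, b], forall x, {for x, continuous f}} ->
  (\int[mu]_(x in `]a, b[) (f x)%:E = (F b - F a)%:E)%E.
Proof.
move=> ab dF cf.
have cF x : x \in `[a, b] -> {for x, continuous F}.
  move=> xab; have dFx := dF x xab.
  by apply/differentiable_continuous/derivable1_diffP; apply: ex_derive.
have mf : measurable_fun `]a, b[ f.
  apply: open_continuous_measurable_fun; first exact: interval_open.
  by move=> x; rewrite inE /= => xab; apply: cf; exact: subset_itv_oo_cc.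
rewrite -(@integral_itv_bndoo _ _ _ _ true false); last exact/measurable_EFinP.
rewrite (@continuous_FTC2 _ _ F _ _ ab) ?EFinB //.
- by apply: continuous_in_subspaceT => x; rewrite inE /=; exact: cf.
- split.
  + move=> x xab; have dFx := dF x (subset_itv_oo_cc xab).
    exact: ex_derive.
  + apply: cvg_at_right_filter; apply: cF.
    by rewrite in_itv /= lexx ltW.
  + apply: cvg_at_left_filter; apply: cF.
    by rewrite in_itv /= lexx ltW.
- move=> x xab; have dFx := dF x (subset_itv_oo_cc xab).
  by rewrite derive1E derive_val.
Qed.

Lemma integral_inv_sqr (h : R) : 0 < h ->
  (\int[mu]_(y in `]h, +oo[) (y ^- 2)%:E = (h^-1)%:E)%E.
Proof.
move=> h0.
have dF x : h <= x -> is_derive x (1 : R) (fun y : R => - y^-1) (x ^- 2).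
  move=> hx; have x0 : x != 0 by rewrite lt0r_neq0 // (lt_le_trans h0).
  have d1 := @is_deriveV _ id x 1 1 x0 (is_derive_id x 1).
  have d2 := is_deriveN d1.
  apply: (is_derive_eq d2).
  by rewrite scaleNr opprK /GRing.scale /= mulr1.
have cf x : h <= x -> {for x, continuous (fun y : R => y ^- 2)}.
  move=> hx; have x0 : x != 0 by rewrite lt0r_neq0 // (lt_le_trans h0).
  apply: continuousV; first by rewrite expf_neq0.
  exact: exprn_continuous.
have cF x : h <= x -> {for x, continuous (fun y : R => - y^-1)}.
  move=> xab; have dFx := dF x xab.
  by apply/differentiable_continuous/derivable1_diffP; apply: ex_derive.
have mf : measurable_fun `]h, +oo[ (fun y : R => y ^- 2).
  apply: open_continuous_measurable_fun; first exact: interval_open.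
  by move=> x; rewrite inE /= in_itv /= andbT => /ltW; exact: cf.
rewrite integral_itv_obnd_cbnd; last exact/measurable_EFinP.
rewrite (@ge0_continuous_FTC2y _ _ (fun y : R => - y^-1) h 0).
- by rewrite sub0e EFinN oppeK.
- by move=> x hx; rewrite invr_ge0 sqr_ge0.
- apply: continuous_in_subspaceT => x; rewrite inE /= in_itv /= andbT; exact: cf.
- rewrite -oppr0; apply: cvgN; apply/gtr0_cvgV0; last exact: cvg_id.
  exact: nbhs_pinfty_gt.
- move=> x /ltW hx; have dFx := dF x hx; exact: ex_derive.
- by apply: cvg_at_right_filter; exact: cF.
- move=> x; rewrite in_itv /= andbT => /ltW hx; have dFx := dF x hx.
  by rewrite derive1E derive_val.
Qed.

End Calculus.

(** * The geodesic through two points as a graph *)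

Section Arc.
Context {R : realType}.
Notation mu := (@lebesgue_measure R).
Implicit Types P Q z : R * R.

(** In the projective model the geodesic PQ is a chord; the squared ordinate in
    the half-plane is the height of that chord above the parabola. *)
Definition geo_height_sqr P Q (x : R) : R :=
  sqnorm P + (sqnorm Q - sqnorm P) / (Q.1 - P.1) * (x - P.1) - x ^+ 2.

Definition geo_height P Q (x : R) : R := Num.sqrt (geo_height_sqr P Q x).

(** The parabola is convex, hence below its chords. *)
Lemma geo_height_sqr_gt0 P Q x : hplane P -> hplane Q -> P.1 < Q.1 ->
  x \in `[P.1, Q.1] -> 0 < geo_height_sqr P Q x.
Proof.
rewrite /hplane /= in_itv /= => P0 Q0 PQ /andP[Px xQ].
have d0 : 0 < Q.1 - P.1 by rewrite subr_gt0.
have -> : geo_height_sqr P Q x = ((Q.1 - x) * P.2 ^+ 2 + (x - P.1) * Q.2 ^+ 2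
    + (x - P.1) * (Q.1 - x) * (Q.1 - P.1)) / (Q.1 - P.1).
  by rewrite /geo_height_sqr /sqnorm; field; rewrite lt0r_neq0.
rewrite divr_gt0 //.
have a0 : 0 <= x - P.1 by rewrite subr_ge0.
have b0 : 0 <= Q.1 - x by rewrite subr_ge0.
apply: ltr_wpDr; first by rewrite mulr_ge0 ?(ltW d0) // mulr_ge0.
have [xP|nxP] := eqVneq x P.1.
  by rewrite xP subrr mul0r addr0 mulr_gt0 // exprn_gt0.
apply: ltr_wpDl; first by rewrite mulr_ge0 // sqr_ge0.
by rewrite mulr_gt0 ?exprn_gt0 // lt0r a0 subr_eq0 nxP.
Qed.

Lemma geo_height_right P Q : hplane Q -> P.1 < Q.1 -> geo_height P Q Q.1 = Q.2.
Proof.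
rewrite /hplane /geo_height /= => Q0 PQ.
have -> : geo_height_sqr P Q Q.1 = Q.2 ^+ 2.
  by rewrite /geo_height_sqr /sqnorm; field; rewrite subr_eq0 gt_eqF.
by rewrite sqrtr_sqr gtr0_norm.
Qed.

Lemma is_derive_geo_height_sqr P Q x : is_derive x (1 : R) (geo_height_sqr P Q)
  ((sqnorm Q - sqnorm P) / (Q.1 - P.1) - 2 * x).
Proof.
rewrite /geo_height_sqr; set m := (sqnorm Q - sqnorm P) / _.
have d1 := is_deriveB (is_derive_id x (1 : R)) (is_derive_cst P.1 x (1 : R)).
have d2 := is_deriveZ m d1.
have d3 := is_deriveD (is_derive_cst (sqnorm P) x (1 : R)) d2.
have d4 := is_deriveB d3 (is_deriveX 2 (is_derive_id x (1 : R))).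
apply: (is_derive_eq d4).
by rewrite /GRing.scale /= expr1; ring.
Qed.

Lemma is_derive_geo_height P Q x : 0 < geo_height_sqr P Q x ->
  is_derive x (1 : R) (geo_height P Q)
  (((sqnorm Q - sqnorm P) / (Q.1 - P.1) - 2 * x) / (2 * geo_height P Q x)).
Proof.
move=> g0.
have d := is_derive1_comp (is_derive1_sqrt g0) (is_derive_geo_height_sqr P Q x).
by apply: (is_derive_eq d); rewrite mulrC.
Qed.

Lemma arc_angle_identity (x p q h m : R) : 0 < h -> 0 < q ->
  h ^+ 2 = q ^+ 2 + m * (x - p) - (x ^+ 2 - p ^+ 2) ->
  2 * ((1 + ((x - p) * (q + h)^-1) ^+ 2)^-1 *
    ((x - p) * (- (q + h) ^- 2 * ((m - 2 * x) / (2 * h))) + (q + h)^-1)) = h^-1.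
Proof.
move=> h0 q0 hE.
have qh : 0 < q + h by rewrite addr_gt0.
have D0 : 0 < (q + h) ^+ 2 + (x - p) ^+ 2.
  by apply: ltr_wpDr; [rewrite sqr_ge0 | rewrite exprn_gt0].
have DE : (q + h) ^+ 2 + (x - p) ^+ 2 = 2 * h * (q + h) - (x - p) * (m - 2 * x).
  apply/eqP; rewrite -subr_eq0; apply/eqP.
  have -> : (q + h) ^+ 2 + (x - p) ^+ 2 - (2 * h * (q + h) - (x - p) * (m - 2 * x))
    = (q ^+ 2 + m * (x - p) - (x ^+ 2 - p ^+ 2)) - h ^+ 2 by ring.
  by rewrite hE subrr.
have -> : 1 + ((x - p) * (q + h)^-1) ^+ 2 =
    ((q + h) ^+ 2 + (x - p) ^+ 2) / (q + h) ^+ 2.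
  by field; rewrite lt0r_neq0.
have -> : (x - p) * (- (q + h) ^- 2 * ((m - 2 * x) / (2 * h))) + (q + h)^-1 =
    ((q + h) ^+ 2 + (x - p) ^+ 2) / (2 * h * (q + h) ^+ 2).
  by rewrite DE; field; rewrite !lt0r_neq0.
by field; rewrite !lt0r_neq0.
Qed.

(** On the half-circle carrying the arc, dx / y is minus the differential of
    the central angle; the angle subtended by the arc from P to (x, y) is
    twice the arctangent of (x - x_P) / (y_P + y) by the half-angle formula.
    Written this way, the antiderivative mentions neither centre nor radius,
    and it is smooth up to both ends of the arc. *)
Lemma is_derive_arc_angle P Q x : hplane P -> 0 < geo_height_sqr P Q x ->
  is_derive x (1 : R) (fun x => 2 * atan ((x - P.1) / (P.2 + geo_height P Q x)))
   (geo_height P Q x)^-1.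
Proof.
rewrite /hplane /= => P0 g0.
have a0 : 0 < geo_height P Q x by rewrite sqrtr_gt0.
have a2 : geo_height P Q x ^+ 2 = geo_height_sqr P Q x by rewrite sqr_sqrtr // ltW.
have s0 : 0 < P.2 + geo_height P Q x by rewrite addr_gt0.
have d1 := is_deriveB (is_derive_id x (1 : R)) (is_derive_cst P.1 x (1 : R)).
have d2 := is_deriveD (is_derive_cst P.2 x (1 : R)) (is_derive_geo_height P Q x g0).
have d3 := is_deriveM d1
  (@is_deriveV _ (cst P.2 + geo_height P Q) _ _ _ (lt0r_neq0 s0) d2).
have d4 := is_derive1_comp (is_derive1_atan _) d3.
have d5 := is_deriveZ 2 d4.
apply: (is_derive_eq d5).
rewrite /GRing.scale /= !fctE /= subr0 add0r mulr1.
apply: arc_angle_identity => //.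
by rewrite a2 /geo_height_sqr /sqnorm; ring.
Qed.

End Arc.

(** * The area above a geodesic arc *)

Section Upper.
Context {R : realType}.
Notation mu := (@lebesgue_measure R).
Notation mu2 := (mu \x mu)%E.
Implicit Types P Q z : R * R.

Lemma measurable_set_gt0 (f : R * R -> R) : measurable_fun setT f ->
  measurable [set z | 0 < f z].
Proof.
move=> mf.
have -> : [set z | 0 < f z] = setT `&` f @^-1` `]0, +oo[.
  by rewrite setTI; apply/seteqP; split=> z /=; rewrite in_itv /= andbT.
by apply: mf; [exact: measurableT|exact: measurable_itv].
Qed.

Lemma measurable_set_ge0 (f : R * R -> R) : measurable_fun setT f ->
  measurable [set z | 0 <= f z].
Proof.
move=> mf.
have -> : [set z | 0 <= f z] = setT `&` f @^-1` `[0, +oo[.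
  by rewrite setTI; apply/seteqP; split=> z /=; rewrite in_itv /= andbT.
by apply: mf; [exact: measurableT|exact: measurable_itv].
Qed.

Lemma measurable_set_eq0 (f : R * R -> R) : measurable_fun setT f ->
  measurable [set z | f z = 0].
Proof.
move=> mf.
have -> : [set z | f z = 0] = setT `&` f @^-1` [set 0].
  by rewrite setTI; apply/seteqP; split=> z /=.
by apply: mf; [exact: measurableT|exact: measurable_set1].
Qed.

Lemma measurable_sqnorm : measurable_fun setT (@sqnorm R).
Proof.
apply: measurable_funD; apply: measurable_funX;
  [exact: measurable_fst|exact: measurable_snd].
Qed.

Lemma measurable_klein_affine (p q r : R) :
  measurable_fun setT (fun z : R * R => p * sqnorm z + q * z.1 + r).
Proof.
apply: measurable_funD => //; apply: measurable_funD.
  by apply: measurable_funM => //; exact: measurable_sqnorm.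
by apply: measurable_funM => //; exact: measurable_fst.
Qed.

Lemma orient_klein_affine P Q z : orient P Q z =
  (Q.1 - P.1) * sqnorm z + - (sqnorm Q - sqnorm P) * z.1 +
   (P.1 * (sqnorm Q - sqnorm P) - sqnorm P * (Q.1 - P.1)).
Proof. by rewrite /orient; ring. Qed.

Lemma measurable_orient P Q : measurable_fun setT (orient P Q).
Proof.
have -> : orient P Q = fun z => (Q.1 - P.1) * sqnorm z + - (sqnorm Q - sqnorm P) * z.1 +
   (P.1 * (sqnorm Q - sqnorm P) - sqnorm P * (Q.1 - P.1)).
  by apply/funext => z; exact: orient_klein_affine.
exact: measurable_klein_affine.
Qed.

(** The points above the arc PQ.  The set is empty unless P is strictly to the
    left of Q, so for any two points only one of the two directions of the
    edge contributes. *)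
Definition upper P Q : set (R * R) :=
  [set z | [/\ hplane z, P.1 < z.1, z.1 < Q.1 & 0 < orient P Q z]].

Lemma measurable_hplane : measurable (@hplane R).
Proof. by apply: measurable_set_gt0; exact: measurable_snd. Qed.

Lemma measurable_upper P Q : measurable (upper P Q).
Proof.
have -> : upper P Q = hplane `&` [set z | 0 < z.1 - P.1] `&`
   [set z | 0 < Q.1 - z.1] `&` [set z | 0 < orient P Q z].
  apply/seteqP; split => z /=; rewrite (subr_gt0 P.1) (subr_gt0 z.1).
    by move=> [? ? ? ?]; do !split.
  by move=> [[[? ?] ?] ?]; split.
apply: measurableI; last by apply: measurable_set_gt0; exact: measurable_orient.
apply: measurableI; last first.
  by apply: measurable_set_gt0; apply: measurable_funB => //; exact: measurable_fst.
apply: measurableI; first exact: measurable_hplane.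
by apply: measurable_set_gt0; apply: measurable_funB => //; exact: measurable_fst.
Qed.

Definition area_density (z : R * R) : \bar R := (z.2 ^- 2)%:E.

Lemma area_density_ge0 z : (0 <= area_density z)%E.
Proof. by rewrite lee_fin invr_ge0 sqr_ge0. Qed.

Lemma measurable_invr : measurable_fun setT (@GRing.inv R).
Proof.
rewrite -(setvU [set 0]); apply/measurable_funU => //.
- exact: measurableC.
split; last exact: measurable_fun_set1.
apply: open_continuous_measurable_fun.
  by apply: closed_openC; exact: closed_eq.
by move=> x; rewrite inE /= => /eqP x0; exact: inv_continuous.
Qed.

Lemma measurable_area_density : measurable_fun setT area_density.
Proof.
apply/measurable_EFinP.
apply: (measurableT_comp measurable_invr).
by apply: measurable_funX; exact: measurable_snd.
Qed.

Lemma orient_geo_height P Q (x y : R) : P.1 < Q.1 ->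
  orient P Q (x, y) = (Q.1 - P.1) * (y ^+ 2 - geo_height_sqr P Q x).
Proof.
move=> PQ; rewrite /orient /geo_height_sqr /sqnorm /=.
by field; rewrite subr_eq0 gt_eqF.
Qed.

(** Over x the slice is the half-line above the height of the arc, on which
    the integral of dy / y^2 is the inverse of that height; what remains is
    the integral of dx / y along the arc. *)
Lemma integral_upper P Q : hplane P -> hplane Q -> P.1 < Q.1 ->
  (\int[mu2]_(z in upper P Q) area_density z =
   (2 * atan ((Q.1 - P.1) / (P.2 + Q.2)))%:E)%E.
Proof.
move=> P0 Q0 PQ.
have d0 : 0 < Q.1 - P.1 by rewrite subr_gt0.
rewrite integral_mkcond fubini_tonelli1; last 2 first.
- apply/(measurable_restrictT _ (measurable_upper P Q)).
  exact: measurable_funTS measurable_area_density.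
- by move=> z; apply: erestrict_ge0 => w _; exact: area_density_ge0.
have slice x : fubini_F mu (area_density \_ (upper P Q)) x =
    ((fun x => ((geo_height P Q x)^-1)%:E) \_ `]P.1, Q.1[) x.
  rewrite /fubini_F [RHS]patchE; case: ifPn => [|xPQ].
    rewrite inE /= => xPQ.
    have g0 : 0 < geo_height_sqr P Q x.
      by apply: geo_height_sqr_gt0 => //; exact: subset_itv_oo_cc.
    have h0 : 0 < geo_height P Q x by rewrite sqrtr_gt0.
    rewrite -integral_inv_sqr // [RHS]integral_mkcond; apply: eq_integral => y _.
    rewrite !patchE; congr (if _ then _ else _).
    move: xPQ; rewrite in_itv /= => /andP[Px xQ].
    apply/idP/idP; rewrite !inE /= in_itv /= andbT.
      move=> [/= y0 _ _]; rewrite orient_geo_height // pmulr_rgt0 // subr_gt0 => hy.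
      by rewrite -(@ltr_pXn2r _ 2) ?nnegrE ?ltW // sqr_sqrtr // ltW.
    move=> hy; have y0 : 0 < y by exact: lt_trans hy.
    split => //=; rewrite orient_geo_height // mulr_gt0 // subr_gt0.
    by rewrite -(@sqr_sqrtr _ (geo_height_sqr P Q x)) ?ltW // ltr_pXn2r ?nnegrE ?ltW.
  apply: integral0_eq => y _; rewrite patchE ifF //.
  apply/negP; rewrite inE /= => -[/= _ h1 h2 _]; move/negP: xPQ; apply.
  by rewrite inE /= in_itv /= h1 h2.
transitivity (\int[mu]_(x in `]P.1, Q.1[) ((geo_height P Q x)^-1)%:E)%E.
  by rewrite [RHS]integral_mkcond; apply: eq_integral => x _; exact: slice.
pose F x := 2 * atan ((x - P.1) / (P.2 + geo_height P Q x)).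
have -> := @integral_itvoo_FTC R (fun x => (geo_height P Q x)^-1) F P.1 Q.1 PQ.
- by rewrite /F geo_height_right // subrr mul0r atan0 mulr0 subr0.
- by move=> x xPQ; apply: is_derive_arc_angle => //; exact: geo_height_sqr_gt0.
- move=> x xPQ; have g0 := geo_height_sqr_gt0 P Q x P0 Q0 PQ xPQ.
  have da := is_derive_geo_height P Q x g0.
  apply: continuousV; first by rewrite lt0r_neq0 // sqrtr_gt0.
  by apply/differentiable_continuous/derivable1_diffP; apply: ex_derive.
Qed.

End Upper.

(** * Geodesics are null sets *)

Section Null.
Context {R : realType}.
Notation mu := (@lebesgue_measure R).
Notation mu2 := (mu \x mu)%E.
Implicit Types P Q z : R * R.

(** Each vertical meets the zero set in at most two points when p is nonzero;
    otherwise the zero set is itself a vertical line. *)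
Lemma klein_affine_null (p q r : R) : p != 0 \/ q != 0 ->
  mu2 [set z | p * sqnorm z + q * z.1 + r = 0] = 0%E.
Proof.
have [-> [/eqP//|q0]|p0 _] := eqVneq p 0.
  have -> : [set z : R * R | 0 * sqnorm z + q * z.1 + r = 0] = [set - r / q] `*` setT.
    apply/seteqP; split => z /=; rewrite mul0r add0r.
      move/eqP; rewrite addr_eq0 => /eqP <-; split => //.
      by rewrite mulrAC mulfV // mul1r.
    by case=> -> _; rewrite mulrC divfK // addNr.
  rewrite product_measure1E //.
  by rewrite [X in (X * _)%E](lebesgue_measure_set1 (- r / q)) mul0e.
rewrite /product_measure1; apply: integral0_eq => x _ /=.
pose s := Num.sqrt ((- r - q * x) / p - x ^+ 2).
apply: countable_lebesgue_measure0; apply: finite_set_countable.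
apply: (@sub_finite_set _ _ [set s; - s]); last first.
  by rewrite finite_setU; split; exact: finite_set1.
move=> y; rewrite /xsection /= inE /= /sqnorm /= => e.
have ys : y ^+ 2 = s ^+ 2.
  have y2 : y ^+ 2 = (- r - q * x) / p - x ^+ 2.
    apply: (mulfI p0); rewrite mulrBr [p * (_ / p)]mulrC divfK //.
    by apply/eqP; rewrite -subr_eq0 -[X in _ == X]e; apply/eqP; ring.
  by rewrite /s sqr_sqrtr -y2 // sqr_ge0.
by move/eqP: ys; rewrite eqf_sqr => /orP[]/eqP ->; [left|right].
Qed.

Lemma ae_klein_affine_neq0 (p q r : R) : p != 0 \/ q != 0 ->
  {ae mu2, forall z, p * sqnorm z + q * z.1 + r != 0}.
Proof.
move=> pq; exists [set z | p * sqnorm z + q * z.1 + r = 0]; split.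
- by apply: measurable_set_eq0; exact: measurable_klein_affine.
- exact: klein_affine_null.
- by move=> z /= /negP; rewrite negbK => /eqP.
Qed.

Lemma ae_orient_neq0 P Q : Q.1 != P.1 \/ sqnorm Q != sqnorm P ->
  {ae mu2, forall z, orient P Q z != 0}.
Proof.
move=> PQ.
have [N [mN N0 sub]] := @ae_klein_affine_neq0 (Q.1 - P.1) (- (sqnorm Q - sqnorm P))
  (P.1 * (sqnorm Q - sqnorm P) - sqnorm P * (Q.1 - P.1))
  ltac:(rewrite oppr_eq0 !subr_eq0; exact: PQ).
exists N; split => // z h; apply: sub => /= h'; apply: h => /=.
by rewrite orient_klein_affine.
Qed.

Lemma ae_fst_neq (x : R) : {ae mu2, forall z, x - z.1 != 0}.
Proof.
have [N [mN N0 sub]] := @ae_klein_affine_neq0 0 (-1) x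
  ltac:(right; rewrite oppr_eq0; exact: oner_neq0).
exists N; split => // z h; apply: sub => /= h'; apply: h => /=.
by move: h'; rewrite mul0r add0r mulN1r addrC.
Qed.

End Null.

(** * The area of a convex quadrilateral *)

Section Area.
Context {R : realType}.
Notation mu := (@lebesgue_measure R).
Notation mu2 := (mu \x mu)%E.
Implicit Types A B C D P Q z : R * R.

(** The combinatorial content of the winding number.  Here a, b, c say whether
    the vertices A, B, C lie to the right of a given point, and p, q, r whether
    the point is on the positive side of BC, CA, AB.  The hypotheses record
    that, in a vanishing sum of three products with these signs, the terms do
    not all have the same sign. *)
Lemma crossing_bool (a b c p q r : bool) :
  ~~ [&& p == a, q == b & r == c] -> ~~ [&& p != a, q != b & r != c] ->
  ([&& ~~ a, b & r] + [&& ~~ b, c & p] + [&& ~~ c, a & q]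
     + [&& ~~ r, ~~ p & ~~ q] =
   [&& ~~ b, a & ~~ r] + [&& ~~ c, b & ~~ p] + [&& ~~ a, c & ~~ q]
     + [&& r, p & q])%N.
Proof. by case: a; case: b; case: c; case: p; case: q; case: r. Qed.

Lemma mulr_gt0_signs (s a : R) : s != 0 -> a != 0 -> (0 < s * a) = ((0 < s) == (0 < a)).
Proof.
move=> s0 a0; case: (ltgtP 0 s) s0 => // hs _.
  by rewrite pmulr_rgt0.
rewrite nmulr_rgt0 //; case: (ltgtP 0 a) a0 => //.
Qed.

Lemma mulr_lt0_signs (s a : R) : s != 0 -> a != 0 -> (s * a < 0) = ((0 < s) != (0 < a)).
Proof.
move=> s0 a0; rewrite -mulr_gt0_signs //.
by rewrite lt_neqAle mulf_neq0 //= -leNgt.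
Qed.

(** Boolean, so that crossings can be counted in [nat]. *)
Definition above P Q z : bool :=
  [&& P.1 < z.1, z.1 < Q.1 & 0 < orient P Q z].

Definition in_triangle A B C z : bool :=
  [&& 0 < orient A B z, 0 < orient B C z & 0 < orient C A z].

(** A ray going down from z crosses the boundary with total index one when z
    is in the triangle and zero otherwise.  The oriented areas of z with the
    three sides are barycentric coordinates, which gives the linear relation
    required by [crossing_bool]. *)
Lemma triangle_crossing A B C z : 0 < orient A B C ->
  A.1 - z.1 != 0 -> B.1 - z.1 != 0 -> C.1 - z.1 != 0 ->
  orient A B z != 0 -> orient B C z != 0 -> orient C A z != 0 ->
  (above A B z + above B C z + above C A z =
   above B A z + above C B z + above A C z + in_triangle A B C z)%N.
Proof.
move=> ABC a0 b0 c0 r0 p0 q0.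
have e : orient B C z * (A.1 - z.1) + orient C A z * (B.1 - z.1)
   + orient A B z * (C.1 - z.1) = 0 by rewrite /orient; ring.
have s : orient A B z + orient B C z + orient C A z = orient A B C.
  by rewrite /orient; ring.
have ltN (x : R) : x != 0 -> ~~ (0 < x) = (x < 0).
  by move=> x0; rewrite -leNgt le_eqVlt (negPf x0).
have aboveE P Q : P.1 - z.1 != 0 ->
    above P Q z = [&& ~~ (0 < P.1 - z.1), 0 < Q.1 - z.1 & 0 < orient P Q z].
  by move=> P0; rewrite ltN // subr_lt0 subr_gt0.
have aboveNE P Q : P.1 - z.1 != 0 -> orient Q P z != 0 ->
    above P Q z = [&& ~~ (0 < P.1 - z.1), 0 < Q.1 - z.1 & ~~ (0 < orient Q P z)].
  by move=> P0 QP0; rewrite aboveE // (ltN (orient _ _ _)) // orient_swap oppr_gt0.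
rewrite (aboveE A) // (aboveE B C) // (aboveE C A) //.
rewrite (aboveNE B A) // (aboveNE C B) // (aboveNE A C) //.
rewrite -crossing_bool; last 2 first.
- apply/negP => /and3P[]; rewrite -!mulr_gt0_signs // => x y w.
  by have := addr_gt0 (addr_gt0 x y) w; rewrite e ltxx.
- apply/negP => /and3P[]; rewrite -!mulr_lt0_signs // -!oppr_gt0 => x y w.
  by have := addr_gt0 (addr_gt0 x y) w; rewrite -!opprD e oppr0 ltxx.
(* the three orientations add up to that of the triangle, which is positive *)
suff -> : [&& ~~ (0 < orient A B z), ~~ (0 < orient B C z) & ~~ (0 < orient C A z)]
   = false by rewrite addn0.
apply/negP => /and3P[]; rewrite !ltN // -!oppr_gt0 => x y w.
have := addr_gt0 (addr_gt0 (addr_gt0 x y) w) ABC.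
by rewrite -s -!opprD addNr ltxx.
Qed.

Definition in_quad A B C D z : bool :=
  [&& 0 <= orient A B z, 0 <= orient B C z, 0 <= orient C D z & 0 <= orient D A z].

(** Off the diagonal AC, the sides of a convex quadrilateral that bound one of
    the two triangles force the other two inequalities. *)
Lemma in_quad_triangles A B C D z : ccw_quad A B C D -> orient A C z != 0 ->
  orient A B z != 0 -> orient B C z != 0 -> orient C D z != 0 -> orient D A z != 0 ->
  (in_quad A B C D z = in_triangle A B C z + in_triangle A C D z :> nat)%N.
Proof.
move=> [ABC BCD CDA DAB] h ab bc cd da.
have lt0 (x : R) : x != 0 -> (0 <= x) = (0 < x).
  by move=> x0; rewrite [RHS]lt_neqAle eq_sym x0.
rewrite /in_quad /in_triangle (orient_swap A C) !lt0 // oppr_gt0.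
have T1 : 0 < orient A B z -> 0 < orient B C z -> orient A C z < 0 ->
    0 < orient C D z /\ 0 < orient D A z.
  rewrite -oppr_gt0 -orient_swap => c0 a0 b0.
  have e1 : orient C D z * orient A B C =
      orient C D A * orient B C z + orient B C D * orient C A z.
    by rewrite /orient; ring.
  have e2 : orient D A z * orient A B C =
      orient D A B * orient C A z + orient C D A * orient A B z.
    by rewrite /orient; ring.
  split; rewrite -(pmulr_lgt0 _ ABC) ?e1 ?e2 addr_gt0 // mulr_gt0 //.
have T2 : 0 < orient C D z -> 0 < orient D A z -> 0 < orient A C z ->
    0 < orient A B z /\ 0 < orient B C z.
  move=> c0 a0 b0.
  have e1 : orient A B z * orient C D A =
      orient A B C * orient D A z + orient D A B * orient A C z.
    by rewrite /orient; ring.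
  have e2 : orient B C z * orient C D A =
      orient B C D * orient A C z + orient A B C * orient C D z.
    by rewrite /orient; ring.
  split; rewrite -(pmulr_lgt0 _ CDA) ?e1 ?e2 addr_gt0 // mulr_gt0 //.
case: (ltgtP 0 (orient A C z)) h => // hAC _; rewrite ?andbF ?andbT /=.
- rewrite add0n; congr nat_of_bool.
  apply/idP/idP => [/and4P[_ _ -> ->]//|/andP[x y]].
  by have [-> ->] := T2 x y hAC; rewrite x y.
- rewrite addn0; congr nat_of_bool.
  apply/idP/idP => [/and4P[-> -> _ _]//|/andP[x y]].
  by have [-> ->] := T1 x y hAC; rewrite x y.
Qed.

(** The crossings of the diagonal AC cancel between the two triangles. *)
Lemma quad_crossing A B C D z : ccw_quad A B C D ->
  A.1 - z.1 != 0 -> B.1 - z.1 != 0 -> C.1 - z.1 != 0 -> D.1 - z.1 != 0 ->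
  orient A B z != 0 -> orient B C z != 0 -> orient C D z != 0 ->
  orient D A z != 0 -> orient A C z != 0 ->
  (in_quad A B C D z
    + (above B A z + above C B z + above D C z + above A D z) =
   above A B z + above B C z + above C D z + above D A z)%N.
Proof.
move=> Q a0 b0 c0 d0 ab bc cd da ac; case: (Q) => [ABC BCD CDA DAB].
have ca : orient C A z != 0 by rewrite orient_swap oppr_eq0.
have ACD : 0 < orient A C D by rewrite -orient_cycle.
have := triangle_crossing A B C z ABC a0 b0 c0 ab bc ca.
have := triangle_crossing A C D z ACD a0 c0 d0 ac cd da.
rewrite (in_quad_triangles A B C D) //.
clear; move: (nat_of_bool (above A C z)) (nat_of_bool (above C A z))
  (nat_of_bool (above A B z)) (nat_of_bool (above B A z))
  (nat_of_bool (above B C z)) (nat_of_bool (above C B z))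
  (nat_of_bool (above C D z)) (nat_of_bool (above D C z))
  (nat_of_bool (above D A z)) (nat_of_bool (above A D z))
  (nat_of_bool (in_triangle A B C z)) (nat_of_bool (in_triangle A C D z)).
clear; lia.
Qed.

Definition edge_area P Q : R :=
  if P.1 < Q.1 then 2 * atan ((Q.1 - P.1) / (P.2 + Q.2)) else 0.

Lemma integral_upperE P Q : hplane P -> hplane Q ->
  (\int[mu2]_(z in upper P Q) area_density z = (edge_area P Q)%:E)%E.
Proof.
move=> P0 Q0; rewrite /edge_area; case: ifPn => PQ; first exact: integral_upper.
rewrite (_ : upper P Q = set0) ?integral_set0 //.
apply/seteqP; split => z //= -[_ Pz zQ _].
by move: PQ; rewrite (lt_trans Pz zQ).
Qed.

(** The region above an edge counts positively in one direction and negatively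
    in the other; oddness of atan makes the signed area one formula, which
    also covers vertical edges. *)
Lemma edge_areaB P Q :
  edge_area P Q - edge_area Q P = 2 * atan ((Q.1 - P.1) / (P.2 + Q.2)).
Proof.
have e : (P.1 - Q.1) / (Q.2 + P.2) = - ((Q.1 - P.1) / (P.2 + Q.2)).
  by rewrite -mulNr opprB [Q.2 + _]addrC.
rewrite /edge_area; case: ltgtP => PQ.
- by rewrite subr0.
- by rewrite e atanN mulrN sub0r opprK.
- by rewrite subrr PQ subrr mul0r atan0 mulr0.
Qed.

Lemma orient_neq P Q z : 0 < orient P Q z -> Q.1 != P.1 \/ sqnorm Q != sqnorm P.
Proof.
move=> h; have [e1|] := eqVneq Q.1 P.1; last by left.
have [e2|] := eqVneq (sqnorm Q) (sqnorm P); last by right.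
by move: h; rewrite /orient e1 e2 !subrr !mul0r subrr ltxx.
Qed.

Lemma measurable_quad_region A B C D : measurable (quad_region A B C D).
Proof.
have -> : quad_region A B C D = hplane `&` [set z | 0 <= orient A B z] `&`
   [set z | 0 <= orient B C z] `&` [set z | 0 <= orient C D z] `&`
   [set z | 0 <= orient D A z].
  apply/seteqP; split => z /=; first by move=> [? [? ? ? ?]]; do !split.
  by move=> [[[[? ?] ?] ?] ?]; split.
do 4 (apply: measurableI; last by
  apply: measurable_set_ge0; exact: measurable_orient).
exact: measurable_hplane.
Qed.

Lemma restrict_area_density (X : set (R * R)) (b : bool) z : (z \in X) = b ->
  (area_density \_ X) z = (z.2 ^- 2 * (b : nat)%:R)%:E.
Proof. by rewrite patchE => ->; case: b; rewrite ?mulr1 ?mulr0. Qed.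

Lemma ge0_integralD4 (f1 f2 f3 f4 : R * R -> \bar R) :
  measurable_fun setT f1 -> measurable_fun setT f2 ->
  measurable_fun setT f3 -> measurable_fun setT f4 ->
  (forall z, 0 <= f1 z)%E -> (forall z, 0 <= f2 z)%E ->
  (forall z, 0 <= f3 z)%E -> (forall z, 0 <= f4 z)%E ->
  (\int[mu2]_z f1 z + \int[mu2]_z f2 z + \int[mu2]_z f3 z + \int[mu2]_z f4 z =
   \int[mu2]_z (f1 z + f2 z + f3 z + f4 z))%E.
Proof.
move=> m1 m2 m3 m4 p1 p2 p3 p4.
rewrite ge0_integralD //; last 2 first.
- by move=> z _; rewrite !adde_ge0.
- by do 2 (apply: emeasurable_funD => //).
rewrite ge0_integralD //; last 2 first.
- by move=> z _; rewrite !adde_ge0.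
- by apply: emeasurable_funD.
by rewrite ge0_integralD.
Qed.

(** [quad_crossing] integrated against the area density.  The negative terms
    are moved to the left, so that only integrals of nonnegative functions
    occur, and the identity holds off the lines carrying the sides, the
    diagonal AC and the verticals through the vertices. *)
Lemma integral_crossing A B C D :
  hplane A -> hplane B -> hplane C -> hplane D -> ccw_quad A B C D ->
  (\int[mu2]_(z in quad_region A B C D) area_density z +
   (\int[mu2]_(z in upper B A) area_density z + \int[mu2]_(z in upper C B) area_density z +
    \int[mu2]_(z in upper D C) area_density z + \int[mu2]_(z in upper A D) area_density z) =
   \int[mu2]_(z in upper A B) area_density z + \int[mu2]_(z in upper B C) area_density z +
    \int[mu2]_(z in upper C D) area_density z + \int[mu2]_(z in upper D A) area_density z)%E.
Proof.
move=> A0 B0 C0 D0 Q; case: (Q) => [ABC BCD CDA DAB].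
have mU P P' : measurable_fun setT (area_density \_ (upper P P')).
  apply/(measurable_restrictT _ (measurable_upper P P')).
  exact: measurable_funTS measurable_area_density.
have mQ : measurable_fun setT (area_density \_ (quad_region A B C D)).
  apply/(measurable_restrictT _ (measurable_quad_region A B C D)).
  exact: measurable_funTS measurable_area_density.
have w0 X z : (0 <= (area_density \_ X) z)%E.
  by apply: erestrict_ge0 => w _; exact: area_density_ge0.
have mk X : (\int[mu2]_(z in X) area_density z = \int[mu2]_z (area_density \_ X) z)%E.
  exact: integral_mkcond.
rewrite !mk.
rewrite !ge0_integralD4 // -ge0_integralD //; last 2 first.
- by move=> z _; rewrite !adde_ge0.
- by do 3 (apply: emeasurable_funD; last exact: mU); exact: mU.
apply: ge0_ae_eq_integral => //.
- apply: emeasurable_funD; first exact: mQ.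
  by do 3 (apply: emeasurable_funD; last exact: mU); exact: mU.
- by do 3 (apply: emeasurable_funD; last exact: mU); exact: mU.
- by move=> z _; rewrite !adde_ge0.
- by move=> z _; rewrite !adde_ge0.
have ACD : 0 < orient A C D by rewrite -orient_cycle.
have n1 := ae_orient_neq0 A B (orient_neq A B C ABC).
have n2 := ae_orient_neq0 B C (orient_neq B C D BCD).
have n3 := ae_orient_neq0 C D (orient_neq C D A CDA).
have n4 := ae_orient_neq0 D A (orient_neq D A B DAB).
have n5 := ae_orient_neq0 A C (orient_neq A C D ACD).
have n6 := ae_fst_neq A.1.
have n7 := ae_fst_neq B.1.
have n8 := ae_fst_neq C.1.
have n9 := ae_fst_neq D.1.
near=> z => _.
have [z0|nz0] := pselect (hplane z); last first.
  have U P P' : (area_density \_ (upper P P')) z = 0%E.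
    by rewrite patchE; case: ifPn => //; rewrite inE => -[].
  rewrite !U !adde0 patchE; case: ifPn => //; rewrite inE => -[] //.
have U P P' : (area_density \_ (upper P P')) z = (z.2 ^- 2 * (above P P' z : nat)%:R)%:E.
  apply: restrict_area_density; apply/idP/idP; rewrite inE /above.
    by case=> _ -> -> ->.
  by move=> /and3P[? ? ?]; split.
have V : (area_density \_ (quad_region A B C D)) z =
    (z.2 ^- 2 * (in_quad A B C D z : nat)%:R)%:E.
  apply: restrict_area_density; apply/idP/idP; rewrite inE /in_quad.
    by case=> _ [-> -> -> ->].
  by move=> /and4P[? ? ? ?]; split.
rewrite !U V -!EFinD -!mulrDr -!natrD; congr (_ * _%:R)%:E.
apply: quad_crossing => //.
all: near: z.
all: by [].
Unshelve. all: by end_near. Qed.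

Lemma harea_quad_region A B C D :
  hplane A -> hplane B -> hplane C -> hplane D -> ccw_quad A B C D ->
  harea (quad_region A B C D) =
  2 * (atan ((B.1 - A.1) / (A.2 + B.2)) + atan ((C.1 - B.1) / (B.2 + C.2)) +
       atan ((D.1 - C.1) / (C.2 + D.2)) + atan ((A.1 - D.1) / (D.2 + A.2))).
Proof.
move=> A0 B0 C0 D0 Q.
have := integral_crossing A B C D A0 B0 C0 D0 Q.
rewrite !integral_upperE // /harea /Rintegral -!EFinD.
case: integral => //= S [] e.
have := edge_areaB A B; have := edge_areaB B C.
have := edge_areaB C D; have := edge_areaB D A.
rewrite !mulrDr => <- <- <- <-.
apply: (addIr (edge_area B A + edge_area C B + edge_area D C + edge_area A D)).
by rewrite e; ring.
Qed.

End Area.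

(** * Cycles and the order of the vertices *)

Section Cyclic.
Context {R : realType}.
Implicit Types z w A B C D : R * R.

Definition disc (l : oline R) : R := be l ^+ 2 - 4 * al l * ga l.

(** Cosh of the distance from z to l: the normalised value of [oside] is the
    Minkowski product of z with the unit normal of l, which is sinh of that
    distance. *)
Definition line_cosh z (l : oline R) : R :=
  Num.sqrt (1 + (oside l z / z.2) ^+ 2 / disc l).

Lemma line_cosh_arg_ge1 z l : 1 <= 1 + (oside l z / z.2) ^+ 2 / disc l.
Proof. by rewrite lerDl divr_ge0 ?sqr_ge0 // ltW // oline_disc. Qed.

Lemma line_cosh_ge1 z l : 1 <= line_cosh z l.
Proof.
have h := line_cosh_arg_ge1 z l.
by rewrite -[X in X <= _]sqrtr1 ler_sqrt // (le_trans ler01).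
Qed.

(** The Gram determinant of z, w and the normal (2 ga, - be, 2 al) of l, when w
    is on l: again the square of a determinant. *)
Lemma gram_line z w (l : oline R) : oside l w = 0 ->
  disc l * (hform z w ^+ 2 - z.2 ^+ 2 * w.2 ^+ 2) - oside l z ^+ 2 * w.2 ^+ 2 =
  ((sqnorm z * (w.1 * 2 * al l + be l) - z.1 * (sqnorm w * 2 * al l - 2 * ga l)
     - (sqnorm w * be l + w.1 * 2 * ga l)) / 2) ^+ 2.
Proof.
move=> lw.
have -> : oside l z ^+ 2 * w.2 ^+ 2 =
    oside l z ^+ 2 * w.2 ^+ 2 + oside l w ^+ 2 * z.2 ^+ 2
     - 2 * hform z w * oside l z * oside l w.
  by rewrite lw; ring.
by rewrite /disc /hform /oside /sqnorm; field.
Qed.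

Lemma line_cosh_le z w (l : oline R) : hplane z -> hplane w -> oside l w = 0 ->
  line_cosh z l <= cosh (hdist z w).
Proof.
move=> z0 w0 lw; have c1 := cosh_ge1 (hdist z w).
rewrite -(@ler_pXn2r _ 2) ?nnegrE ?sqrtr_ge0 ?(le_trans ler01) //.
rewrite sqr_sqrtr ?(le_trans ler01 (line_cosh_arg_ge1 _ _)) // cosh_hdist //.
rewrite /hplane /= in z0 w0; have d0 : 0 < disc l := oline_disc l.
rewrite -subr_ge0.
have -> : (hform z w / (z.2 * w.2)) ^+ 2 - (1 + (oside l z / z.2) ^+ 2 / disc l) =
  (disc l * (hform z w ^+ 2 - z.2 ^+ 2 * w.2 ^+ 2) - oside l z ^+ 2 * w.2 ^+ 2)
   / (disc l * (z.2 * w.2) ^+ 2).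
  by field; rewrite !lt0r_neq0.
rewrite gram_line // divr_ge0 ?sqr_ge0 // mulr_ge0 ?sqr_ge0 //.
exact: ltW.
Qed.

(** The foot of the perpendicular: subtract from the vector of z its component
    along the normal of l, and normalise. *)
Lemma foot_exists z (l : oline R) : hplane z ->
  exists w, [/\ hplane w, oside l w = 0 & cosh (hdist z w) = line_cosh z l].
Proof.
move=> z0; have d0 : 0 < disc l := oline_disc l.
pose o := oside l z.
pose r := disc l + 2 * al l * o.
have y0 : 0 < z.2 by [].
have r0 : 0 < r.
  have -> : r = 2 * al l ^+ 2 * z.2 ^+ 2 + (2 * al l * z.1 + be l) ^+ 2 / 2
     + disc l / 2.
    by rewrite /r /o /oside /disc; field.
  apply: ltr_wpDl; last by rewrite divr_gt0.
  apply: addr_ge0; last by rewrite divr_ge0 ?sqr_ge0.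
  by rewrite mulr_ge0 ?sqr_ge0 // mulr_ge0 ?sqr_ge0.
pose s := disc l * (disc l * z.2 ^+ 2 + o ^+ 2).
have m0 : 0 < disc l * z.2 ^+ 2 + o ^+ 2.
  by rewrite ltr_wpDr ?sqr_ge0 // mulr_gt0 // exprn_gt0.
have s0 : 0 < s by rewrite mulr_gt0.
have s20 : 0 < Num.sqrt s by rewrite sqrtr_gt0.
(* the vector disc * (sqnorm z, z.1, 1) + o * (2 ga, - be, 2 al) is orthogonal to
   the normal; r is its last coordinate and s its Minkowski square *)
pose w := ((disc l * z.1 - be l * o) / r, Num.sqrt s / r).
have w0 : hplane w by rewrite /hplane /= divr_gt0.
have wE : sqnorm w = (disc l * sqnorm z + 2 * ga l * o) / r.
  rewrite /sqnorm /= expr_div_n [X in _ + X]expr_div_n sqr_sqrtr ?ltW //.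
  apply: (mulIf (lt0r_neq0 (exprn_gt0 2 r0))).
  rewrite mulrDl !divfK ?expf_neq0 ?lt0r_neq0 //.
  rewrite expr2 mulrA divfK ?lt0r_neq0 //.
  by rewrite /s /r /o /oside /disc /sqnorm; ring.
exists w; split => //.
  rewrite /oside -/(sqnorm w) wE /=.
  have -> : al l * ((disc l * sqnorm z + 2 * ga l * o) / r) +
    be l * ((disc l * z.1 - be l * o) / r) + ga l =
   (al l * (disc l * sqnorm z + 2 * ga l * o) + be l * (disc l * z.1 - be l * o)
     + ga l * r) / r.
    by field; rewrite lt0r_neq0.
  rewrite (_ : _ + _ = 0) ?mul0r //.
  by rewrite /r /o /oside /disc /sqnorm; ring.
apply/eqP; rewrite -(@eqrXn2 _ 2) ?sqrtr_ge0 //; last first.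
  by rewrite (le_trans ler01) ?cosh_ge1.
rewrite sqr_sqrtr ?(le_trans ler01 (line_cosh_arg_ge1 _ _)) // cosh_hdist //.
have kE : hform z w = (disc l * z.2 ^+ 2 + o ^+ 2) / r.
  rewrite /hform wE /=.
  have -> : (sqnorm z + (disc l * sqnorm z + 2 * ga l * o) / r) / 2 -
    z.1 * ((disc l * z.1 - be l * o) / r) =
    ((sqnorm z * r + disc l * sqnorm z + 2 * ga l * o) / 2
      - z.1 * (disc l * z.1 - be l * o)) / r.
    by field; rewrite lt0r_neq0.
  congr (_ / _).
  by rewrite /r /o /oside /disc /sqnorm; field.
rewrite kE /= -/o.
have -> : (((disc l * z.2 ^+ 2 + o ^+ 2) / r / (z.2 * (Num.sqrt s / r))) ^+ 2) =
   (disc l * z.2 ^+ 2 + o ^+ 2) ^+ 2 / (z.2 ^+ 2 * Num.sqrt s ^+ 2).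
  by field; rewrite !lt0r_neq0.
rewrite sqr_sqrtr ?ltW // /s; apply/eqP.
move: m0; move: (o) (disc l) d0 => o' d d0 m0.
by field; rewrite !lt0r_neq0.
Qed.

Lemma hdist_line_cosh z (l : oline R) : hplane z ->
  hdist_line z l = arcosh (line_cosh z l).
Proof.
move=> z0; have [w [w0 lw cw]] := foot_exists z l z0.
have c1 := line_cosh_ge1 z l.
have e : hdist z w = arcosh (line_cosh z l).
  by apply: cosh_inj; rewrite ?hdist_ge0 ?arcosh_ge0 // arcoshK.
have wm : [set hdist z w | w in line_pts l] (arcosh (line_cosh z l)).
  by exists w.
apply/eqP; rewrite eq_le; apply/andP; split.
  apply: ge_inf => //; exists 0 => _ [v [v0 _] <-]; exact: hdist_ge0.
apply: lb_le_inf; first by exists (arcosh (line_cosh z l)).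
move=> _ [v [v0 lv] <-]; apply: ler_cosh; rewrite ?hdist_ge0 ?arcosh_ge0 //.
by rewrite arcoshK //; exact: line_cosh_le.
Qed.

(** The distance to l depends only on the quotient of [oside l z] by the height
    of z, so an equidistant curve is the locus where this quotient is
    constant. *)
Lemma equidistant_oside z (l : oline R) (delta : R) : hplane z -> 0 < oside l z ->
  hdist_line z l = delta ->
  oside l z = Num.sqrt (disc l * (cosh delta ^+ 2 - 1)) * z.2.
Proof.
move=> z0 o0; rewrite hdist_line_cosh // => <-.
have y0 : 0 < z.2 by []. have d0 : 0 < disc l := oline_disc l.
rewrite arcoshK ?line_cosh_ge1 // sqr_sqrtr ?(le_trans ler01 (line_cosh_arg_ge1 _ _)) //.
rewrite [1 + _]addrC addrK mulrCA mulfV ?lt0r_neq0 // mulr1 sqrtr_sqr.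
by rewrite gtr0_norm ?divr_gt0 // divfK // lt0r_neq0.
Qed.

(** Circles, horocycles and equidistant curves are the plane sections of the
    hyperboloid, here the graphs of affine functions of (x, sqnorm). *)
Lemma cycle_klein_affine (K : set (R * R)) :
  [\/ is_hcircle K, is_horocycle K | is_equidistant_branch K] ->
  exists p q r : R, forall z, K z -> z.2 = p * sqnorm z + q * z.1 + r.
Proof.
case.
- case=> c [rho [c0 rho0 ->]]; have y0 : 0 < c.2 by [].
  have k0 : 0 < cosh rho * c.2 by rewrite mulr_gt0 // (lt_le_trans ltr01) ?cosh_ge1.
  exists (2 * (cosh rho * c.2))^-1, (- c.1 / (cosh rho * c.2)),
    (sqnorm c / (2 * (cosh rho * c.2))) => z [z0 cz].
  have z20 : 0 < z.2 by [].
  have : cosh rho * c.2 * z.2 = hform c z.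
    by rewrite -cz cosh_hdist //; field; rewrite !lt0r_neq0.
  move: k0; move: (cosh _ * c.2) => k k0 e.
  apply: (mulfI (lt0r_neq0 k0)); rewrite e /hform.
  by field; rewrite lt0r_neq0.
- case=> [[h [h0 ->]]|[xi [rho [rho0 ->]]]].
    by exists 0, 0, h => z /= ->; rewrite !mul0r !add0r.
  exists (2 * rho)^-1, (- xi / rho), (xi ^+ 2 / (2 * rho)) => z [_ e].
  have e' : (2 * rho) * z.2 = sqnorm z - 2 * xi * z.1 + xi ^+ 2.
    by apply/eqP; rewrite -subr_eq0 -(subrr (rho ^+ 2)) -{2}e /sqnorm; apply/eqP; ring.
  have r2 : 0 < 2 * rho by rewrite mulr_gt0.
  apply: (mulfI (lt0r_neq0 r2)); rewrite e'.
  by field; rewrite lt0r_neq0.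
- case=> l [delta [delta0 ->]].
  pose k := Num.sqrt (disc l * (cosh delta ^+ 2 - 1)).
  exists (al l / k), (be l / k), (ga l / k) => z [z0 o0 dz].
  have e := equidistant_oside z l delta z0 o0 dz; rewrite -/k in e.
  have k0 : k != 0 by apply: contraTneq o0 => k0; rewrite e k0 mul0r ltxx.
  apply: (mulfI k0); rewrite -e /oside /sqnorm.
  by field.
Qed.

(** Real part of (B - A) * conj (C - B), with points read as complex numbers. *)
Definition edges_dot A B C : R :=
  (B.1 - A.1) * (C.1 - B.1) + (B.2 - A.2) * (C.2 - B.2).

(** Imaginary part of (B - A) * conj (C - B). *)
Definition edges_cross A B C : R :=
  (B.2 - A.2) * (C.1 - B.1) - (B.1 - A.1) * (C.2 - B.2).

(** The two expressions are the imaginary and the real part of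
    G = (B - A) (D - C) conj ((C - B) (A - D)).  The imaginary part is the
    determinant of the rows (sqnorm, x, 1, y), which vanishes because y is an
    affine combination of the other columns.  For the real part, if the cycle
    is a Euclidean circle (p nonzero) the exterior angles at B and D, whose
    sum is a multiple of pi, have sines of the same sign; if it is a line
    (p = 0), the sign is that of the product of the four steps along it. *)
Lemma ccw_concyclic_edges A B C D (p q r : R) :
  A.2 = p * sqnorm A + q * A.1 + r -> B.2 = p * sqnorm B + q * B.1 + r ->
  C.2 = p * sqnorm C + q * C.1 + r -> D.2 = p * sqnorm D + q * D.1 + r ->
  0 < orient A B C -> 0 < orient C D A ->
  edges_dot A B C * edges_cross C D A + edges_cross A B C * edges_dot C D A = 0 /\
  edges_dot A B C * edges_dot C D A - edges_cross A B C * edges_cross C D A <= 0.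
Proof.
move=> eA eB eC eD ABC CDA.
set ur := edges_dot A B C; set ui := edges_cross A B C.
set vr := edges_dot C D A; set vi := edges_cross C D A.
have im : ur * vi + ui * vr = 0.
  have -> : ur * vi + ui * vr = A.2 * orient B C D - B.2 * orient C D A
     + C.2 * orient D A B - D.2 * orient A B C.
    by rewrite /ur /ui /vr /vi /edges_dot /edges_cross /orient /sqnorm; ring.
  by rewrite eA eB eC eD /orient; ring.
split => //.
have uiE : ui = - p * orient A B C
  by rewrite /ui /edges_cross eA eB eC /orient; ring.
have viE : vi = - p * orient C D A
  by rewrite /vi /edges_cross eA eC eD /orient; ring.
have [p0|p0] := eqVneq p 0.
  have dE (P Q : R * R) : P.2 = p * sqnorm P + q * P.1 + r ->
      Q.2 = p * sqnorm Q + q * Q.1 + r -> P.2 - Q.2 = q * (P.1 - Q.1).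
    by move=> -> ->; rewrite p0; ring.
  rewrite uiE viE p0 oppr0 !mul0r subr0.
  have -> : ur * vr = (1 + q ^+ 2) ^+ 2 *
     ((B.1 - A.1) * (C.1 - B.1) * (D.1 - C.1) * (A.1 - D.1)).
    rewrite /ur /vr /edges_dot.
    by rewrite (dE B A) // (dE C B) // (dE D C) // (dE A D) //; ring.
  rewrite mulr_ge0_le0 ?sqr_ge0 // leNgt; apply/negP => P0.
  have := mulr_gt0 ABC CDA.
  have -> : orient A B C * orient C D A = - ((1 + q ^+ 2) ^+ 2 * (C.1 - A.1) ^+ 2 *
     ((B.1 - A.1) * (C.1 - B.1) * (D.1 - C.1) * (A.1 - D.1))).
    have kE (P Q : R * R) : P.2 = p * sqnorm P + q * P.1 + r ->
      Q.2 = p * sqnorm Q + q * Q.1 + r ->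
      sqnorm P - sqnorm Q = (P.1 - Q.1) * (P.1 + Q.1 + q * (q * (P.1 + Q.1) + 2 * r)).
      by rewrite p0 !mul0r !add0r {1 2}/sqnorm => -> ->; ring.
    rewrite /orient (kE C A) // (kE B A) // (kE A C) // (kE D C) //.
    by ring.
  rewrite oppr_gt0 ltNge => /negP; apply.
  by rewrite mulr_ge0 ?(ltW P0) // mulr_ge0 ?sqr_ge0.
have h : ur * orient C D A = - (orient A B C * vr).
  apply: (mulfI (_ : - p != 0)); first by rewrite oppr_eq0.
  apply/eqP; rewrite -subr_eq0 -[X in _ == X]im uiE viE; apply/eqP; ring.
rewrite subr_le0 (@le_trans _ _ 0) //; last first.
  rewrite uiE viE mulrACA mulr_ge0 //;
    first by rewrite mulNr mulrN opprK -expr2 sqr_ge0.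
  by rewrite mulr_ge0 // ltW.
rewrite -(pmulr_lle0 _ CDA) mulrAC h mulNr oppr_le0 -mulrA.
by rewrite mulr_ge0 ?(ltW ABC) // -expr2 sqr_ge0.
Qed.

(** A line through A and B is a multiple of [orient A B], so C and D are on the
    same side of AB.  Multiplying by the squared coefficients of the line
    avoids choosing which of them is nonzero. *)
Lemma supporting_side_orient A B C D : supporting_side A B C D ->
  A != B -> hplane A -> hplane B -> 0 < orient A B C * orient A B D.
Proof.
case=> l [lA lB lC lD] AB A0 B0.
set c := oside l C in lC; set d := oside l D in lD.
have kE z : oside l z = al l * (sqnorm z - sqnorm A) + be l * (z.1 - A.1).
  by rewrite -[LHS]subr0 -[X in _ - X]lA /oside /sqnorm; ring.
have eB : al l * (sqnorm B - sqnorm A) + be l * (B.1 - A.1) = 0 by rewrite -kE.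
have a1 z : al l * orient A B z = (B.1 - A.1) * oside l z.
  rewrite kE -[RHS]subr0 -(mul0r (z.1 - A.1)) -eB /orient; ring.
have b1 z : be l * orient A B z = - (sqnorm B - sqnorm A) * oside l z.
  rewrite kE -[RHS]addr0 -(mul0r (sqnorm z - sqnorm A)) -eB /orient; ring.
have key : (al l ^+ 2 + be l ^+ 2) * (orient A B C * orient A B D) =
    ((B.1 - A.1) ^+ 2 + (sqnorm B - sqnorm A) ^+ 2) * (c * d).
  have -> : (al l ^+ 2 + be l ^+ 2) * (orient A B C * orient A B D) =
    (al l * orient A B C) * (al l * orient A B D) +
    (be l * orient A B C) * (be l * orient A B D) by ring.
  by rewrite !a1 !b1 -/c -/d; ring.
have N0 : 0 < (B.1 - A.1) ^+ 2 + (sqnorm B - sqnorm A) ^+ 2.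
  rewrite lt0r addr_ge0 ?sqr_ge0 // andbT paddr_eq0 ?sqr_ge0 // !sqrf_eq0 !subr_eq0.
  apply: contra AB => /andP[/eqP e1 /eqP e2]; apply/eqP/esym; exact: sqnorm_inj.
have ab0 : 0 <= al l ^+ 2 + be l ^+ 2 by rewrite addr_ge0 ?sqr_ge0.
have h := mulr_gt0 N0 (mulr_gt0 lC lD); rewrite -key in h.
rewrite -(pmulr_rgt0 _ (_ : 0 < al l ^+ 2 + be l ^+ 2)) //.
by rewrite lt0r ab0 andbT; apply: contraTneq h => ->; rewrite mul0r ltxx.
Qed.

Lemma supporting_side_neq A B C D : supporting_side A B C D -> B != C.
Proof.
by case=> l [lA lB lC lD]; apply/eqP => e; move: lC; rewrite -e lB ltxx.
Qed.

(** Each supporting line gives equal signs to two consecutive triples of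
    vertices; three of the lines link all four triples. *)
Lemma convex_quadrilateral_ccw A B C D : convex_quadrilateral A B C D ->
  ccw_quad A B C D \/ ccw_quad D C B A.
Proof.
case=> -[A0 B0 C0 D0] [sAB sBC sCD sDA].
have bc := supporting_side_neq _ _ _ _ sAB.
have cd := supporting_side_neq _ _ _ _ sBC.
have da := supporting_side_neq _ _ _ _ sCD.
have ab := supporting_side_neq _ _ _ _ sDA.
have h1 := supporting_side_orient _ _ _ _ sAB ab A0 B0.
have h2 := supporting_side_orient _ _ _ _ sBC bc B0 C0.
have h3 := supporting_side_orient _ _ _ _ sCD cd C0 D0.
rewrite (orient_cycle D A B) in h1.
rewrite (orient_cycle A B C) in h2.
rewrite (orient_cycle B C D) in h3.
have rev (P Q S : R * R) : orient P Q S = - orient S Q P by rewrite /orient; ring.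
rewrite /ccw_quad (rev D C B) (rev C B A) (rev B A D) (rev A D C) !oppr_gt0.
have mul_sg (x y : R) : 0 < x * y -> (0 < x) = (0 < y) /\ (x < 0) = (y < 0).
  move=> xy; case: (ltgtP 0 x) => x0.
  - by move: xy; rewrite pmulr_rgt0 // => y0; rewrite y0 (lt_gtF y0).
  - by move: xy; rewrite nmulr_rgt0 // => y0; rewrite y0 (lt_gtF y0).
  - by move: xy; rewrite -x0 mul0r ltxx.
have [p1 n1] := mul_sg _ _ h1; have [p2 n2] := mul_sg _ _ h2.
have [p3 n3] := mul_sg _ _ h3.
rewrite -p1 p3 !p2 -n1 n3 !n2.
case: (ltgtP 0 (orient A B C)) h1 => [x _|x _|<-]; [by left|by right|].
by rewrite mul0r ltxx.
Qed.

End Cyclic.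

(** * The half-area *)

Section Final.
Context {R : realType}.
Implicit Types z w A B C D : R * R.

Lemma sin_atan (t : R) : sin (atan t) = t * cos (atan t).
Proof.
have c0 : cos (atan t) != 0.
  by rewrite cos_atan invr_eq0 sqrtr_eq0 -ltNge ltr_pwDl // sqr_ge0.
by rewrite -{2}(atanK t) /tan divfK.
Qed.

(** The complex number (y + y') + i (x' - x) has squared modulus
    4 y y' cosh^2 (d / 2). *)
Lemma cos_edge z w : hplane z -> hplane w ->
  cos (atan ((w.1 - z.1) / (z.2 + w.2))) =
  (z.2 + w.2) / (2 * Num.sqrt z.2 * Num.sqrt w.2 * cosh (hdist z w / 2)).
Proof.
move=> z0 w0; have y0 : 0 < z.2 by []. have v0 : 0 < w.2 by [].
have s0 : 0 < Num.sqrt z.2 by rewrite sqrtr_gt0.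
have t0 : 0 < Num.sqrt w.2 by rewrite sqrtr_gt0.
have c0 := cosh_gt0 (hdist z w / 2).
rewrite cos_atan.
set M := 2 * _ * _ * _.
have M0 : 0 < M by rewrite mulr_gt0 // mulr_gt0 // mulr_gt0.
have yv : 0 < z.2 + w.2 by rewrite addr_gt0.
have M2 : M ^+ 2 = (z.2 + w.2) ^+ 2 + (w.1 - z.1) ^+ 2.
  have := sqr_cosh_half (hdist z w); rewrite /M; move: (cosh (_ / 2)) => c cE.
  rewrite !exprMn !sqr_sqrtr ?ltW // cE cosh_hdist // /hform /sqnorm.
  by field; rewrite !lt0r_neq0.
have -> : 1 + ((w.1 - z.1) / (z.2 + w.2)) ^+ 2 = (M / (z.2 + w.2)) ^+ 2.
  by rewrite [RHS]expr_div_n M2; field; rewrite lt0r_neq0.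
by rewrite sqrtr_sqr gtr0_norm ?divr_gt0 // invf_div.
Qed.

Lemma sin_edge z w : hplane z -> hplane w ->
  sin (atan ((w.1 - z.1) / (z.2 + w.2))) =
  (w.1 - z.1) / (2 * Num.sqrt z.2 * Num.sqrt w.2 * cosh (hdist z w / 2)).
Proof.
move=> z0 w0; rewrite sin_atan cos_edge // mulrA divfK //.
by rewrite lt0r_neq0 // addr_gt0.
Qed.

Lemma cosD4 (a b c d : R) : cos (a + b + c + d) =
  (cos a * cos b - sin a * sin b) * (cos c * cos d - sin c * sin d) -
  (sin a * cos b + cos a * sin b) * (sin c * cos d + cos c * sin d).
Proof. by rewrite -addrA cosD !cosD !sinD. Qed.

Lemma sqr_sinh_half_hdist z w : hplane z -> hplane w ->
  sinh (hdist z w / 2) ^+ 2 =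
  ((w.1 - z.1) ^+ 2 + (w.2 - z.2) ^+ 2) / (4 * z.2 * w.2).
Proof.
move=> z0 w0; have y0 : 0 < z.2 by []. have v0 : 0 < w.2 by [].
rewrite sqr_sinh_half cosh_hdist // /hform /sqnorm.
by field; rewrite !lt0r_neq0.
Qed.

(** The squared product of the sinh is the squared modulus of G up to the
    heights, because 2 sinh (PQ / 2) is the Euclidean length of PQ divided by
    sqrt (y_P y_Q).  As G is real and nonpositive, its modulus is - G. *)
Lemma prod_sinh_half A B C D :
  hplane A -> hplane B -> hplane C -> hplane D ->
  edges_dot A B C * edges_cross C D A + edges_cross A B C * edges_dot C D A = 0 ->
  edges_dot A B C * edges_dot C D A - edges_cross A B C * edges_cross C D A <= 0 ->
  16 * A.2 * B.2 * C.2 * D.2 * (sinh (hdist A B / 2) * sinh (hdist B C / 2) *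
     sinh (hdist C D / 2) * sinh (hdist D A / 2)) =
  edges_cross A B C * edges_cross C D A - edges_dot A B C * edges_dot C D A.
Proof.
move=> A0 B0 C0 D0.
set ur := edges_dot A B C; set ui := edges_cross A B C.
set vr := edges_dot C D A; set vi := edges_cross C D A.
move=> im re.
have yA : 0 < A.2 by []. have yB : 0 < B.2 by [].
have yC : 0 < C.2 by []. have yD : 0 < D.2 by [].
have s0 z w : hplane z -> hplane w -> 0 <= sinh (hdist z w / 2).
  by move=> z0 w0; rewrite sinh_ge0 // divr_ge0 // hdist_ge0.
have sAB := sqr_sinh_half_hdist A B A0 B0; have sBC := sqr_sinh_half_hdist B C B0 C0.
have sCD := sqr_sinh_half_hdist C D C0 D0; have sDA := sqr_sinh_half_hdist D A D0 A0.
have := s0 A B A0 B0; have := s0 B C B0 C0; have := s0 C D C0 D0.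
have := s0 D A D0 A0.
move: (sinh _) (sinh _) (sinh _) (sinh _) sAB sBC sCD sDA => s1 s2 s3 s4.
move=> e1 e2 e3 e4 p4 p3 p2 p1.
apply/eqP; rewrite -(@eqrXn2 _ 2) //; last 2 first.
- by rewrite !mulr_ge0 // ltW.
- by rewrite subr_ge0 -subr_le0.
apply/eqP; rewrite !exprMn e1 e2 e3 e4.
have -> : (ui * vi - ur * vr) ^+ 2 = (ur ^+ 2 + ui ^+ 2) * (vr ^+ 2 + vi ^+ 2).
  transitivity ((ui * vi - ur * vr) ^+ 2 + (ur * vi + ui * vr) ^+ 2); last by ring.
  by rewrite im expr0n addr0.
rewrite /ur /ui /vr /vi /edges_dot /edges_cross.
by field; rewrite !lt0r_neq0.
Qed.

(** The real part of the product of the four factors (y + y') + i (x' - x):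
    the terms in [hform] will become the sum of the cosh, and the remainder is
    the real part of G. *)
Lemma product_identity A B C D :
  ((A.2 + B.2) * (B.2 + C.2) - (B.1 - A.1) * (C.1 - B.1)) *
  ((C.2 + D.2) * (D.2 + A.2) - (D.1 - C.1) * (A.1 - D.1)) -
  ((B.1 - A.1) * (B.2 + C.2) + (A.2 + B.2) * (C.1 - B.1)) *
  ((D.1 - C.1) * (D.2 + A.2) + (C.2 + D.2) * (A.1 - D.1)) =
  4 * (hform A B * C.2 * D.2 + hform B C * D.2 * A.2 +
       hform C D * A.2 * B.2 + hform D A * B.2 * C.2)
  - (edges_cross A B C * edges_cross C D A - edges_dot A B C * edges_dot C D A).
Proof. by rewrite /edges_dot /edges_cross /hform /sqnorm /=; field. Qed.

(** The clearing of denominators for [ccw_area_formula], with the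
    transcendental quantities replaced by variables; q stands for the square
    root of a height y. *)
Lemma cos_sum_algebra (n1 n2 n3 n4 d1 d2 d3 d4 k1 k2 k3 k4 s1 s2 s3 s4
    c1 c2 c3 c4 qA qB qC qD yA yB yC yD : R) :
  0 < c1 -> 0 < c2 -> 0 < c3 -> 0 < c4 ->
  0 < qA -> 0 < qB -> 0 < qC -> 0 < qD ->
  qA ^+ 2 = yA -> qB ^+ 2 = yB -> qC ^+ 2 = yC -> qD ^+ 2 = yD ->
  (n1 * n2 - d1 * d2) * (n3 * n4 - d3 * d4) -
  (d1 * n2 + n1 * d2) * (d3 * n4 + n3 * d4) =
  4 * (k1 * yC * yD + k2 * yD * yA + k3 * yA * yB + k4 * yB * yC)
   - 16 * yA * yB * yC * yD * (s1 * s2 * s3 * s4) ->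
  let D1 := 2 * qA * qB * c1 in let D2 := 2 * qB * qC * c2 in
  let D3 := 2 * qC * qD * c3 in let D4 := 2 * qD * qA * c4 in
  (n1 / D1 * (n2 / D2) - d1 / D1 * (d2 / D2)) *
  (n3 / D3 * (n4 / D4) - d3 / D3 * (d4 / D4)) -
  (d1 / D1 * (n2 / D2) + n1 / D1 * (d2 / D2)) *
  (d3 / D3 * (n4 / D4) + n3 / D3 * (d4 / D4)) =
  (k1 / (yA * yB) + k2 / (yB * yC) + k3 / (yC * yD) + k4 / (yD * yA)
    - 4 * s1 * s2 * s3 * s4) / (4 * c1 * c2 * c3 * c4).
Proof.
move=> c10 c20 c30 c40 qA0 qB0 qC0 qD0 <- <- <- <- H D1 D2 D3 D4.
transitivity (((n1 * n2 - d1 * d2) * (n3 * n4 - d3 * d4) -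
  (d1 * n2 + n1 * d2) * (d3 * n4 + n3 * d4)) /
  (16 * (qA * qB * qC * qD) ^+ 2 * (c1 * c2 * c3 * c4))).
  by rewrite /D1 /D2 /D3 /D4; field; rewrite !lt0r_neq0.
by rewrite H; field; rewrite !lt0r_neq0.
Qed.

Lemma ccw_area_formula A B C D :
  hplane A -> hplane B -> hplane C -> hplane D -> ccw_quad A B C D ->
  (exists p q r : R, [/\ A.2 = p * sqnorm A + q * A.1 + r,
     B.2 = p * sqnorm B + q * B.1 + r, C.2 = p * sqnorm C + q * C.1 + r &
     D.2 = p * sqnorm D + q * D.1 + r]) ->
  cos (harea (quadrilateral A B C D) / 2) =
    (cosh (hdist A B) + cosh (hdist B C) + cosh (hdist C D) + cosh (hdist D A)
       - 4 * sinh (hdist A B / 2) * sinh (hdist B C / 2) * sinh (hdist C D / 2)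
           * sinh (hdist D A / 2))
    / (4 * cosh (hdist A B / 2) * cosh (hdist B C / 2) * cosh (hdist C D / 2)
         * cosh (hdist D A / 2)).
Proof.
move=> A0 B0 C0 D0 Q [p [q [r [eA eB eC eD]]]].
have yA : 0 < A.2 by []. have yB : 0 < B.2 by [].
have yC : 0 < C.2 by []. have yD : 0 < D.2 by [].
case: (Q) => ABC _ CDA _.
have [im re] := ccw_concyclic_edges A B C D p q r eA eB eC eD ABC CDA.
have pS := prod_sinh_half A B C D A0 B0 C0 D0 im re.
have pI := product_identity A B C D.
rewrite -pS in pI.
rewrite quadrilateral_region // harea_quad_region // [2 * _]mulrC mulfK //.
rewrite cosD4 !cos_edge // !sin_edge //.
rewrite !(cosh_hdist _ _ A0 B0, cosh_hdist _ _ B0 C0, cosh_hdist _ _ C0 D0,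
   cosh_hdist _ _ D0 A0).
by apply: cos_sum_algebra => //; rewrite ?cosh_gt0 ?sqrtr_gt0 // sqr_sqrtr // ltW.
Qed.

End Final.

Theorem theorem4p5 (R : realType) (A B C D : R * R) (a b c d S : R)
  (hQ : cyclic_quadrilateral A B C D)
  (ha : a = hdist A B) (hb : b = hdist B C)
  (hc : c = hdist C D) (hd : d = hdist D A)
  (hS : S = harea (quadrilateral A B C D)) :
  cos (S / 2) =
    (cosh a + cosh b + cosh c + cosh d
       - 4 * sinh (a / 2) * sinh (b / 2) * sinh (c / 2) * sinh (d / 2))
    / (4 * cosh (a / 2) * cosh (b / 2) * cosh (c / 2) * cosh (d / 2)).
Proof.
rewrite {}ha {}hb {}hc {}hd {}hS.
case: hQ => cvx [K [Kcyc [KA KB KC KD]]].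
have [p [q [r Kpl]]] := cycle_klein_affine K Kcyc.
case: (cvx) => -[A0 B0 C0 D0] _.
have [Q|Q] := convex_quadrilateral_ccw A B C D cvx.
  by apply: ccw_area_formula => //; exists p, q, r; split; exact: Kpl.
(* reversing a clockwise quadrilateral changes neither its hull nor, up to
   order, its sides *)
have -> : quadrilateral A B C D = quadrilateral D C B A.
  rewrite /quadrilateral; congr hhull; apply/seteqP; split => z /=; tauto.
have -> := ccw_area_formula D C B A D0 C0 B0 A0 Q; last first.
  by exists p, q, r; split; exact: Kpl.
rewrite (hdistC D C) (hdistC C B) (hdistC B A) (hdistC A D).
move: (cosh (hdist A B)) (cosh (hdist B C)) (cosh (hdist C D)) (cosh (hdist D A)).
move: (cosh (hdist A B / 2)) (cosh (hdist B C / 2)) (cosh (hdist C D / 2))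
  (cosh (hdist D A / 2)).
move: (sinh (hdist A B / 2)) (sinh (hdist B C / 2)) (sinh (hdist C D / 2))
  (sinh (hdist D A / 2)) => *.
by congr (_ / _); ring.
Qed.
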